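(* Let $\mathbf{u}\in V$ and $\bar{\mathbf{u}}_h\in V_h$ solve $$\int_\Omega\mathbf{D}\boldsymbol{\epsilon}[\mathbf{u}]:\boldsymbol{\epsilon}[\mathbf{v}]\,d\Omega=f(\mathbf{v})\quad\forall\,\mathbf{v}\in V\qquad\text{and}\qquad\int_\Omega\mathbf{D}\bar{\boldsymbol{\epsilon}}[\bar{\mathbf{u}}_h]:\bar{\boldsymbol{\epsilon}}[\mathbf{v}]\,d\Omega=f(\mathbf{v})\quad\forall\,\mathbf{v}\in V_h$$ (the latter being the strain-smoothed element method), respectively. Then $$|||\boldsymbol{\epsilon}[\mathbf{u}]-\bar{\boldsymbol{\epsilon}}[\bar{\mathbf{u}}_h]|||_Y\le2\inf_{\mathbf{v}\in V_h}|||\boldsymbol{\epsilon}[\mathbf{u}]-\bar{\boldsymbol{\epsilon}}[\mathbf{v}]|||_Y+C_B\Big(\inf_{\boldsymbol{\tau}_1\in W_{1,h}}|||\boldsymbol{\sigma}[\mathbf{u}]-\boldsymbol{\tau}_1|||_{Y^*}+\inf_{\boldsymbol{\tau}_2\in W_{2,h}}|||\boldsymbol{\sigma}[\mathbf{u}]-\boldsymbol{\tau}_2|||_{Y^*}\Big),$$ where $\boldsymbol{\epsilon}[\mathbf{v}]=\mathbf{B}\mathbf{v}$, $\boldsymbol{\sigma}[\mathbf{v}]=\mathbf{D}\mathbf{B}\mathbf{v}$, $\bar{\boldsymbol{\epsilon}}[\mathbf{v}]=P_{2,h}P_{1,h}(\mathbf{B}\mathbf{v})$, and $C_B$ is the constant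 defined in the context.
   Context: Elasticity setting. $\Omega\subset\mathbb{R}^2$ is a bounded polygonal domain, with $\partial\Omega=\Gamma_D\cup\Gamma_N$, $\Gamma_D\neq\emptyset$, $\Gamma_N=\partial\Omega\setminus\Gamma_D$. $V=\{\mathbf{u}\in (H^1(\Omega))^2:\mathbf{u}=\mathbf{0}\text{ on }\Gamma_D\}$, $W=(L^2(\Omega))^3$. For $\mathbf{u}=(u_x,u_y)\in V$, $\mathbf{B}\mathbf{u}=(\partial_x u_x,\ \partial_y u_y,\ \partial_y u_x+\partial_x u_y)^T\in W$. $\mathbf{D}$ is a constant symmetric positive definite $3\times3$ matrix, and $:$ is the Euclidean inner product of $\mathbb{R}^3$. The bilinear form $a(\mathbf{u},\mathbf{v})=\int_\Omega\mathbf{D}\mathbf{B}\mathbf{u}:\mathbf{B}\mathbf{v}\,d\Omega$ is taken to be symmetric, continuous and coercive on $V$. $f$ is the continuous linear functional on $V$ given by $f(\mathbf{u})=\int_\Omega\mathbf{b}\cdot\mathbf{u}\,d\Omega+\int_{\Gamma_N}\mathbf{t}\cdot\mathbf{u}\,d\Gamma$. Energy norms: $|||\boldsymbol{\epsilon}|||_Y^2=\int_\Omega\mathbf{D}\boldsymbol{\epsilon}:\boldsymbol{\epsilon}\,d\Omega$ and $|||\boldsymbol{\sigma}|||_{Y^*}^2=\int_\Omega\boldsymbol{\sigma}:\mathbf{D}^{-1}\boldsymbol{\sigma}\,d\Omega$ for $\boldsymbol{\epsilon},\boldsymbol{\sigma}\in W$. $\mathcal{P}_n(K)$ denotes polynomials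 of degree $\le n$ on $K$. Displacement space. (i) Triangular element: $\mathcal{T}_h$ is a quasi-uniform triangulation of $\Omega$ with maximum element diameter $h>0$ and $V_h=\{\mathbf{u}\in V:\mathbf{u}|_T\in(\mathcal{P}_1(T))^2\ \forall T\in\mathcal{T}_h\}$. (ii) Quadrilateral element: $\mathcal{T}_h$ is a quasi-uniform subdivision of $\Omega$ into quadrilaterals with maximum diameter $h>0$; each $T$ has nodes $\mathbf{x}_{T,1},\dots,\mathbf{x}_{T,4}$ and center point $\mathbf{x}_{T,0}$ (the average of the nodes); $\widehat{\mathcal{T}}_h$ is the triangulation obtained by subdividing each $T$ into the four triangles spanned by $\mathbf{x}_{T,0}$ and an edge of $T$; and $V_h=\{\mathbf{u}\in V:\mathbf{u}|_{\widehat T}\in(\mathcal{P}_1(\widehat T))^2\ \forall\widehat T\in\widehat{\mathcal{T}}_h,\ \mathbf{u}(\mathbf{x}_{T,0})=\frac14\sum_{i=1}^4\mathbf{u}(\mathbf{x}_{T,i})\ \forall T\in\mathcal{T}_h\}$. The statement applies to either element. Auxiliary subdivisions (''center'' means centroid for triangles and $\mathbf{x}_{T,0}$ for quadrilaterals). $\mathcal{T}_{1,h}$ is the subdivision of $\Omega$ consisting, for each edge $e$ shared by two elements of $\mathcal{T}_h$, of the quadrilateral whose vertices are the endpoints of $e$ and the centers of the two elements, and, for each boundary edge $e$, of the triangle whose vertices are the endpoints of $e$ and the center of the element containing $e$. $\mathcal{T}_{2,h}$ is obtained by partitioning each element of $\mathcal{T}_h$ into pieces (three for triangles, four for quadrilaterals)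 by joining its center to the midpoints of its edges. For $k=1,2$, $W_{k,h}=\{\boldsymbol{\epsilon}\in W:\boldsymbol{\epsilon}|_T\in(\mathcal{P}_0(T))^3\ \forall T\in\mathcal{T}_{k,h}\}$, and $P_{k,h}:W\to W_{k,h}$ is $(P_{k,h}\boldsymbol{\epsilon})(x)=\frac{1}{|T|}\int_T\boldsymbol{\epsilon}\,d\Omega$ for $x\in T\in\mathcal{T}_{k,h}$. The constant $C_B$. Let $Z=\{(\mathbf{v},\mathbf{B}\mathbf{v},\mathbf{B}\mathbf{v}):\mathbf{v}\in V\}$ and $Z_h=\{(\mathbf{v},P_{1,h}(\mathbf{B}\mathbf{v}),P_{2,h}P_{1,h}(\mathbf{B}\mathbf{v})):\mathbf{v}\in V_h\}$. $C_B$ denotes a positive constant such that $$\int_\Omega\boldsymbol{\tau}_1:(\mathbf{B}\mathbf{v}-\boldsymbol{\delta}_1)\,d\Omega+\int_\Omega\boldsymbol{\tau}_2:(\boldsymbol{\delta}_1-\boldsymbol{\delta}_2)\,d\Omega\le C_B\,|||\boldsymbol{\delta}_2|||_Y\,\big(|||\boldsymbol{\tau}_1|||_{Y^*}^2+|||\boldsymbol{\tau}_2|||_{Y^*}^2\big)^{1/2}$$ for all $(\mathbf{v},\boldsymbol{\delta}_1,\boldsymbol{\delta}_2)\in Z\cup Z_h$ and $\boldsymbol{\tau}_1,\boldsymbol{\tau}_2\in W$. *)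

(* Defs.v *)
From HB Require Import structures.
From mathcomp Require Import all_boot all_order all_algebra.
From mathcomp Require Import all_classical all_reals all_analysis.

Set Implicit Arguments.
Unset Strict Implicit.
Unset Printing Implicit Defensive.

Import Order.TTheory GRing.Theory Num.Theory.
Import numFieldNormedType.Exports.

Local Open Scope classical_set_scope.
Local Open Scope ring_scope.

(* The plane as a measurable space, with the sigma-algebra on which the
   two-dimensional Lebesgue measure is defined by the library; convertible to
   R * R, which carries the topology. *)
Notation mplane R := (measurableTypeR R * measurableTypeR R)%type.

Section Plane.
Context {R : realType}.
Implicit Types (x y a b c : R * R) (A : set (R * R)).

Definition mu2 : {measure set (mplane R) -> \bar R} :=
  (@lebesgue_measure R \x @lebesgue_measure R)%E.

Definition dist x y : R := Num.sqrt ((x.1 - y.1) ^+ 2 + (x.2 - y.2) ^+ 2).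

Definition diam A : R := sup [set dist x.1 x.2 | x in A `*` A].

Definition seg_pt (e : (R * R) * (R * R)) (s : R) : R * R :=
  (1 - s) *: e.1 + s *: e.2.

Definition segment (e : (R * R) * (R * R)) : set (R * R) :=
  seg_pt e @` [set s | 0 <= s <= 1].

Definition open_segment (e : (R * R) * (R * R)) : set (R * R) :=
  seg_pt e @` [set s | 0 < s < 1].

Definition tri a b c : set (R * R) :=
  [set x | exists r s t : R, [/\ 0 <= r, 0 <= s, 0 <= t, r + s + t = 1 &
                                x = r *: a + s *: b + t *: c]].

(* twice the signed area of the triangle a b c *)
Definition orient a b c : R :=
  (b.1 - a.1) * (c.2 - a.2) - (b.2 - a.2) * (c.1 - a.1).

Definition boundary A : set (R * R) := closure A `\` interior A.

(* [E] lists the sides of [Omega], with non-overlapping interiors; it serves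
   to integrate over the boundary.  The condition on the interior of the
   closure says that [Omega] has no slits.  Holes are allowed. *)
Definition polygonal_domain (Omega : set (R * R))
    (E : seq ((R * R) * (R * R))) : Prop :=
  [/\ [/\ open Omega, connected Omega, Omega !=set0 &
          exists r : R, forall x, Omega x -> dist 0 x <= r],
      interior (closure Omega) = Omega,
      boundary Omega = \bigcup_(e in [set` E]) segment e &
      [/\ uniq E, {in E, forall e, e.1 != e.2} &
          {in E &, forall e e', e != e' ->
             open_segment e `&` open_segment e' = set0}]].

(* Arc-length integrals over the part [G] of the boundary; the pieces of a
   side [e] are parametrized by [0, 1], whence the factor |e|. *)
Definition side_dom (G : set (R * R)) (e : (R * R) * (R * R)) : set R :=
  [set s | 0 <= s <= 1 /\ G (seg_pt e s)].

Definition bd_integral (E : seq ((R * R) * (R * R))) (G : set (R * R))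
    (g : R * R -> R) : R :=
  \sum_(e <- E) dist e.1 e.2 *
    \int[@lebesgue_measure R]_(s in side_dom G e) g (seg_pt e s).

Definition bd_integrable (E : seq ((R * R) * (R * R))) (G : set (R * R))
    (g : R * R -> R) : Prop :=
  {in E, forall e, (@lebesgue_measure R).-integrable (side_dom G e)
                     (fun s => (g (seg_pt e s))%:E)}.

End Plane.

Section Sobolev.
Context {R : realType}.
Implicit Types (Omega : set (R * R)) (E : seq ((R * R) * (R * R)))
  (f g phi : R * R -> R).

Fixpoint Cn (n : nat) phi : Prop :=
  continuous phi /\
  (if n is m.+1 then
     forall v : R * R, (forall x, derivable phi x v) /\
                       Cn m (fun x => 'D_v phi x)
   else True).

Definition smooth phi : Prop := forall n, Cn n phi.

Definition test_function Omega phi : Prop :=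
  smooth phi /\
  (let supp := closure [set x | phi x != 0] in
   compact supp /\ supp `<=` Omega).

Definition L2 Omega f : Prop :=
  measurable_fun (Omega : set (mplane R)) (f : mplane R -> R) /\
  mu2.-integrable Omega (fun x => (f x ^+ 2)%:E).

Definition weak_derivative Omega (e : R * R) f g : Prop :=
  forall phi, test_function Omega phi ->
    \int[mu2]_(x in Omega) (f x * 'D_e phi x) =
    - \int[mu2]_(x in Omega) (g x * phi x).

(* A representative of an element of H^1(Omega), together with
   representatives of its weak partial derivatives and of its boundary
   trace.  All of them are determined almost everywhere by [fn]. *)
Record h1 : Type := H1 {
  fn : R * R -> R;
  dx : R * R -> R;
  dy : R * R -> R;
  trace : R * R -> R
}.

(* The trace map is the continuous extension to H^1(Omega), with values in
   L^2 of the boundary, of the restriction map on smooth functions. *)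
Definition is_trace Omega E (u : h1) : Prop :=
  {in E, forall e, measurable_fun ([set s | 0 <= s <= 1] : set (measurableTypeR R))
                     (fun s : measurableTypeR R => trace u (seg_pt e s))} /\
  bd_integrable E (boundary Omega) (fun x => trace u x ^+ 2) /\
  exists phi : nat -> R * R -> R,
    (forall n, smooth (phi n)) /\
    (fun n => \int[mu2]_(x in Omega)
                ((phi n x - fn u x) ^+ 2
                 + ('D_(1, 0) (phi n) x - dx u x) ^+ 2
                 + ('D_(0, 1) (phi n) x - dy u x) ^+ 2)) @ \oo --> (0 : R) /\
    (fun n => bd_integral E (boundary Omega)
                (fun x => (phi n x - trace u x) ^+ 2)) @ \oo --> (0 : R).

Definition in_H1 Omega E (u : h1) : Prop :=
  [/\ L2 Omega (fn u), L2 Omega (dx u), L2 Omega (dy u),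
      weak_derivative Omega (1, 0) (fn u) (dx u) /\
      weak_derivative Omega (0, 1) (fn u) (dy u) &
      is_trace Omega E u].

Definition zero_trace E (G : set (R * R)) (u : h1) : Prop :=
  {in E, forall e, {ae @lebesgue_measure R,
    forall s, side_dom G e s -> trace u (seg_pt e s) = 0}}.

End Sobolev.

Arguments h1 R : clear implicits.

Section Elasticity.
Context {R : realType}.

Definition displacement : Type := (h1 R * h1 R)%type.
Definition field3 : Type := R * R -> 'cV[R]_3.

Implicit Types (Omega GD GN : set (R * R)) (E : seq ((R * R) * (R * R)))
  (u v : displacement) (eps sig : field3) (D : 'M[R]_3)
  (b t : R * R -> R * R).

Definition ddot (p q : 'cV[R]_3) : R := \sum_i p i 0 * q i 0.

Definition sym_posdef D : Prop :=
  D^T = D /\ forall p : 'cV[R]_3, p != 0 -> 0 < ddot (D *m p) p.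

Definition in_V Omega E GD u : Prop :=
  [/\ in_H1 Omega E u.1, in_H1 Omega E u.2,
      zero_trace E GD u.1 & zero_trace E GD u.2].

Definition V_norm Omega u : R :=
  Num.sqrt (\int[mu2]_(x in Omega)
    (fn u.1 x ^+ 2 + dx u.1 x ^+ 2 + dy u.1 x ^+ 2
     + (fn u.2 x ^+ 2 + dx u.2 x ^+ 2 + dy u.2 x ^+ 2))).

Definition in_W Omega eps : Prop := forall i, L2 Omega (fun x => eps x i 0).

(* B u, the strain epsilon[u] *)
Definition strain u : field3 := fun x =>
  \col_i [:: dx u.1 x; dy u.2 x; dy u.1 x + dx u.2 x]`_i.

(* sigma[u] = D B u *)
Definition stress D u : field3 := fun x => D *m strain u x.

Definition pairing Omega sig eps : R :=
  \int[mu2]_(x in Omega) ddot (sig x) (eps x).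

Definition aform Omega D u v : R :=
  pairing Omega (fun x => D *m strain u x) (strain v).

Definition normY Omega D eps : R :=
  Num.sqrt (pairing Omega (fun x => D *m eps x) eps).

Definition normYs Omega D sig : R :=
  Num.sqrt (pairing Omega sig (fun x => invmx D *m sig x)).

Definition form_symmetric Omega E GD D : Prop :=
  forall u v, in_V Omega E GD u -> in_V Omega E GD v ->
    aform Omega D u v = aform Omega D v u.

Definition form_continuous Omega E GD D : Prop :=
  exists C : R, forall u v, in_V Omega E GD u -> in_V Omega E GD v ->
    `|aform Omega D u v| <= C * V_norm Omega u * V_norm Omega v.

Definition form_coercive Omega E GD D : Prop :=
  exists2 alpha : R, 0 < alpha & forall u, in_V Omega E GD u ->
    alpha * V_norm Omega u ^+ 2 <= aform Omega D u u.

Definition body_work b u (x : R * R) : R :=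
  (b x).1 * fn u.1 x + (b x).2 * fn u.2 x.

Definition traction_work t u (x : R * R) : R :=
  (t x).1 * trace u.1 x + (t x).2 * trace u.2 x.

Definition load Omega E GN b t u : R :=
  \int[mu2]_(x in Omega) body_work b u x
  + bd_integral E GN (traction_work t u).

(* The data [b], [t] are only required to make the load functional well
   defined and continuous on V; its linearity is then automatic. *)
Definition continuous_load Omega E GD GN b t : Prop :=
  (forall v, in_V Omega E GD v ->
     mu2.-integrable Omega (fun x => (body_work b v x)%:E) /\
     bd_integrable E GN (traction_work t v)) /\
  exists C : R, forall v, in_V Omega E GD v ->
    `|load Omega E GN b t v| <= C * V_norm Omega v.

End Elasticity.

Arguments displacement R : clear implicits.
Arguments field3 R : clear implicits.

Variant element_kind := Triangle | Quadrilateral.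

Definition nnodes (k : element_kind) : nat :=
  match k with Triangle => 3 | Quadrilateral => 4 end.

(* An element is given by its nodes, listed counterclockwise. *)
Definition element (k : element_kind) (R : realType) : Type :=
  (nnodes k).-tuple (R * R)%type.

Section Mesh.
Context {k : element_kind} {R : realType}.
Local Notation n := (nnodes k).
Implicit Types (T : n.-tuple (R * R)) (M : seq (n.-tuple (R * R)))
  (i j : 'I_n) (Omega : set (R * R)).

Definition node T i : R * R := tnth T i.

Definition edge T i : (R * R) * (R * R) := (node T i, node T (ordS i)).

(* the centroid for a triangle, x_{T,0} for a quadrilateral *)
Definition center T : R * R := (n%:R : R)^-1 *: \sum_i node T i.

Definition midpoint T i : R * R := seg_pt (edge T i) (2%:R^-1).

(* the triangle spanned by the center and the i-th edge *)
Definition subtri T i : set (R * R) :=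
  tri (center T) (node T i) (node T (ordS i)).

(* the closed region enclosed by the edges of T, when T is a proper element *)
Definition region T : set (R * R) := \bigcup_(i in [set: 'I_n]) subtri T i.

(* Positivity for every i says that a triangle is nondegenerate, and that the
   four triangles spanned by the center of a quadrilateral and its edges
   subdivide it (as is the case for every convex quadrilateral). *)
Definition proper_element T : Prop :=
  forall i, 0 < orient (center T) (node T i) (node T (ordS i)).

Definition conforming T T' : Prop :=
  let I := region T `&` region T' in
  [\/ I = set0,
      exists i j, node T i = node T' j /\ I = [set node T i] |
      exists i j, segment (edge T i) = segment (edge T' j) /\
                  I = segment (edge T i)].

Definition subdivision_of Omega M : Prop :=
  [/\ uniq M,
      {in M, forall T, proper_element T},
      \bigcup_(T in [set` M]) region T = closure Omega &
      {in M &, forall T T', T != T' -> conforming T T'}].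

Definition mesh_size M : R := \big[Num.max/0]_(T <- M) diam (region T).

(* The union of the triangles spanned by the i-th edge of T and the centers of
   all elements having this edge: a quadrilateral if the edge is shared by two
   elements, a triangle if it is a boundary edge. *)
Definition edge_patch M T i : set (R * R) :=
  [set x | exists T' j, [/\ T' \in M,
             segment (edge T' j) = segment (edge T i) & subtri T' j x]].

Definition T1h M : set (set (R * R)) :=
  [set K | exists T i, T \in M /\ K = edge_patch M T i].

(* The piece of T around the common node of its edges i and i+1, cut out by
   joining the center of T to the midpoints of these two edges. *)
Definition node_piece T i : set (R * R) :=
  tri (center T) (midpoint T i) (node T (ordS i)) `|`
  tri (center T) (node T (ordS i)) (midpoint T (ordS i)).

Definition T2h M : set (set (R * R)) :=
  [set K | exists T i, T \in M /\ K = node_piece T i].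

Definition affine_on (A : set (R * R)) (f : R * R -> R) : Prop :=
  exists a b c : R, forall x, A x -> f x = a + b * x.1 + c * x.2.

End Mesh.

(* The members of V_h are represented by their continuous representatives,
   so that nodal values are meaningful. *)
Definition in_Vh (k : element_kind) (R : realType) (Omega : set (R * R))
    (E : seq ((R * R) * (R * R))) (GD : set (R * R)) :
    seq (element k R) -> displacement R -> Prop :=
  match k with
  | Triangle => fun M u =>
      in_V Omega E GD u /\
      {in M, forall T, affine_on (region T) (fn u.1) /\
                       affine_on (region T) (fn u.2)}
  | Quadrilateral => fun M u =>
      in_V Omega E GD u /\
      {in M, forall T,
        (forall i, affine_on (subtri T i) (fn u.1) /\
                   affine_on (subtri T i) (fn u.2)) /\
        fn u.1 (center T) = 4%:R^-1 * \sum_i fn u.1 (node T i) /\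
        fn u.2 (center T) = 4%:R^-1 * \sum_i fn u.2 (node T i)}
  end.

(* [Th h] is the mesh of size h; quasi-uniformity is a property of the whole
   family indexed by the set [hs] of mesh sizes. *)
Definition quasi_uniform_family (k : element_kind) (R : realType)
    (Omega : set (R * R)) (hs : set R) (Th : R -> seq (element k R)) : Prop :=
  (forall h, hs h ->
     [/\ 0 < h, subdivision_of Omega (Th h) & mesh_size (Th h) = h]) /\
  exists2 rho : R, 0 < rho &
    forall h, hs h -> {in Th h, forall T,
      exists x, [set y | dist x y <= rho * h] `<=` region T}.

Section Smoothing.
Context {R : realType}.
Implicit Types (Omega : set (R * R)) (S : set (set (R * R))) (eps : field3 R).

(* W_{k,h}, where S = T_{k,h} *)
Definition in_Wh Omega S eps : Prop :=
  in_W Omega eps /\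
  forall K, S K -> exists c : 'cV[R]_3,
    {ae mu2, forall x, Omega x -> K x -> eps x = c}.

(* The averaging operator over the pieces in S.  On the null set of points
   common to several pieces, one of them is chosen.  The pieces are closed
   whereas [eps] is meaningful on Omega only. *)
Definition piece_at S (x : R * R) : set (R * R) :=
  xget set0 [set K | S K /\ K x].

Definition average Omega eps (K : set (R * R)) : 'cV[R]_3 :=
  \col_i ((fine (mu2 K))^-1 * \int[mu2]_(y in K `&` Omega) eps y i 0).

Definition piecewise_mean Omega S eps : field3 R :=
  fun x => average Omega eps (piece_at S x).

End Smoothing.

Section SmoothedStrain.
Context {k : element_kind} {R : realType}.
Implicit Types (Omega GD : set (R * R)) (E : seq ((R * R) * (R * R)))
  (M : seq (element k R)) (v : displacement R).

Definition P1h Omega M (eps : field3 R) := piecewise_mean Omega (T1h M) eps.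
Definition P2h Omega M (eps : field3 R) := piecewise_mean Omega (T2h M) eps.

Definition smoothed_strain Omega M v : field3 R :=
  P2h Omega M (P1h Omega M (strain v)).

Definition Zset Omega E GD : set (displacement R * field3 R * field3 R) :=
  [set (v, strain v, strain v) | v in in_V Omega E GD].

Definition Zhset Omega E GD M : set (displacement R * field3 R * field3 R) :=
  [set (v, P1h Omega M (strain v), P2h Omega M (P1h Omega M (strain v)))
  | v in in_Vh Omega E GD M].

Definition is_CB Omega E GD (D : 'M[R]_3) M (CB : R) : Prop :=
  0 < CB /\
  forall v d1 d2, (Zset Omega E GD `|` Zhset Omega E GD M) (v, d1, d2) ->
  forall tau1 tau2 : field3 R, in_W Omega tau1 -> in_W Omega tau2 ->
    pairing Omega tau1 (fun x => strain v x - d1 x)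
    + pairing Omega tau2 (fun x => d1 x - d2 x)
    <= CB * normY Omega D d2 *
       Num.sqrt (normYs Omega D tau1 ^+ 2 + normYs Omega D tau2 ^+ 2).

End SmoothedStrain.

(* Main.v *)
(* Strang-type argument.  For v in V_h put w = uh - v.  Both problems have the
   same load on w, so the discrete energy of the smoothed strain of w splits
   into an approximation term, bounded by Cauchy-Schwarz, and the consistency
   term (sigma[u], B w - P2 P1 B w).  Since P1 and P2 are orthogonal projections
   onto W_1h and W_2h, any tau1 and tau2 in these spaces may be subtracted from
   sigma[u] in (sigma[u], B w - P1 B w) and (sigma[u], P1 B w - P2 P1 B w), and
   the inequality defining C_B applies.  The orthogonality needs the pieces of
   each subdivision to cover Omega and to overlap in null sets only; the overlaps
   of the pieces lie on finitely many lines. *)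
Require Import Defs.
From mathcomp Require Import all_boot all_order all_algebra.
From mathcomp Require Import all_classical all_reals all_analysis.
From mathcomp Require Import measurable_realfun.
From mathcomp Require Import ring lra.
Import Order.TTheory GRing.Theory Num.Theory.
Import numFieldNormedType.Exports.
Local Open Scope classical_set_scope.
Local Open Scope ring_scope.

Set Implicit Arguments.
Unset Strict Implicit.
Unset Printing Implicit Defensive.

(** The error is the approximation error of v minus the smoothed strain of w, and the approximation
    error reappears in the bound of the latter: hence the factor 2. The inequality defining C_B
    contains the energy norm of delta_2, here the smoothed strain of w, which is the norm whose
    square is the discrete energy; one factor therefore cancels. It also contains the Euclidean norm
    of the pair of stress errors, which is at most their sum. Two obstacles shape the development.
    An element of H^1 carries its derivatives and its trace as data, so that w in V_h already
    requires subtracting weak derivatives and traces, the latter given by smooth approximation. The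
    pieces of the subdivisions are closed and overlap, so the averaged field at a point depends on a
    chosen piece; the projections are studied on the sets of points with the same choice, which are
    measurable, partition Omega and differ from the pieces by null sets. *)

Section SquareIntegrable.
Context {d : measure_display} {T : measurableType d} {R : realType}.
Variable mu : {measure set T -> \bar R}.
Implicit Types (A B : set T) (f g : T -> R).

(** The measure is abstract because the same facts serve for [mu2] on the domain, where this is [L2]
    by conversion, and for Lebesgue measure on the parameter interval of a side. *)
Definition sq_integrable A f : Prop :=
  measurable_fun A f /\ mu.-integrable A (fun x => (f x ^+ 2)%:E).

Lemma integrable_cstr A (c : R) : measurable A -> (mu A < +oo)%E ->
  mu.-integrable A (fun=> c%:E).
Proof.
move=> mA muA; apply: (@measurable_bounded_integrable _ _ _ mu (cst c)) => //.
by exists `|c|; split; [exact: num_real|move=> M cM x _ /=; exact: ltW].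
Qed.

Lemma sq_integrableM A f g : measurable A ->
  sq_integrable A f -> sq_integrable A g ->
  mu.-integrable A (fun x => (f x * g x)%:E).
Proof.
move=> mA [mf if2] [mg ig2].
apply: (@le_integrable _ _ _ mu A mA _ (fun x => (f x ^+ 2 + g x ^+ 2)%:E)).
- by apply/measurable_EFinP; exact: measurable_funM.
- move=> x _ /=; rewrite lee_fin normrM (@ger0_norm _ (_ + _)); last first.
    by rewrite addr_ge0 // sqr_ge0.
  rewrite -(real_normK (num_real (f x))) -(real_normK (num_real (g x))).
  nra.
- by apply: (integrableD mA if2 ig2).
Qed.

Lemma sq_integrableD A f g : measurable A ->
  sq_integrable A f -> sq_integrable A g ->
  sq_integrable A (fun x => f x + g x).
Proof.
move=> mA sf sg; have ifg := sq_integrableM mA sf sg.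
case: sf sg => [mf if2] [mg ig2]; split; first exact: measurable_funD.
have -> : (fun x => ((f x + g x) ^+ 2)%:E) =
  (fun x => ((f x ^+ 2)%:E + (g x ^+ 2)%:E + (2%:E * (f x * g x)%:E))%E).
  apply/funext => x; rewrite -EFinM -!EFinD; congr EFin; ring.
apply: (integrableD mA); first exact: (integrableD mA).
exact: (integrableZl mA).
Qed.

Lemma sq_integrableZ A (c : R) f : measurable A ->
  sq_integrable A f -> sq_integrable A (fun x => c * f x).
Proof.
move=> mA [mf if2]; split; first exact: measurable_funM.
have -> : (fun x => ((c * f x) ^+ 2)%:E) =
  (fun x => ((c ^+ 2)%:E * (f x ^+ 2)%:E)%E).
  by apply/funext => x; rewrite -EFinM exprMn.
exact: (integrableZl mA).
Qed.

Lemma sq_integrableB A f g : measurable A ->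
  sq_integrable A f -> sq_integrable A g ->
  sq_integrable A (fun x => f x - g x).
Proof.
move=> mA sf sg; under [X in sq_integrable _ X]eq_fun do rewrite -mulN1r.
by apply: sq_integrableD => //; exact: sq_integrableZ.
Qed.

Lemma sq_integrable_sum A (I : Type) (s : seq I) (F : I -> T -> R) :
  measurable A -> (mu A < +oo)%E ->
  (forall i, sq_integrable A (F i)) ->
  sq_integrable A (fun x => \sum_(i <- s) F i x).
Proof.
move=> mA muA sF; elim: s => [|i s ih].
  under [X in sq_integrable _ X]eq_fun do rewrite big_nil.
  split; first exact: measurable_cst.
  exact: integrable_cstr.
under [X in sq_integrable _ X]eq_fun do rewrite big_cons.
exact: sq_integrableD.
Qed.

Lemma bounded_sq_integrable A f (c : R) : measurable A -> (mu A < +oo)%E ->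
  measurable_fun A f -> (forall x, A x -> `|f x| <= c) -> sq_integrable A f.
Proof.
move=> mA muA mf fc; split => //.
apply: (@le_integrable _ _ _ mu A mA _ (fun x => (c ^+ 2)%:E)).
- by apply/measurable_EFinP; exact: measurable_funX.
- move=> x /fc fxc /=; rewrite lee_fin normrX.
  rewrite (ger0_norm (sqr_ge0 c)).
  by rewrite lerXn2r // nnegrE // (le_trans _ fxc).
- exact: integrable_cstr.
Qed.

Lemma sq_integrable_integrable A f : measurable A -> (mu A < +oo)%E ->
  sq_integrable A f -> mu.-integrable A (fun x => (f x)%:E).
Proof.
move=> mA muA sf; under [X in mu.-integrable _ X]eq_fun do rewrite -[f _]mulr1.
apply: sq_integrableM => //.
by apply: (@bounded_sq_integrable _ _ 1) => // x _; rewrite normr1.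
Qed.

End SquareIntegrable.

(** * Lebesgue measure on the plane: open sets, lines, triangles *)

Section PlaneMeasure.
Context {R : realType}.
Implicit Types (A U : set (R * R)) (a b c x y : R * R).

(** The measurable sets of [mplane] form the product sigma-algebra, so an open set is written as the
    countable union of the boxes with rational endpoints that it contains. *)
Lemma open_measurable_plane U : open U -> measurable (U : set (mplane R)).
Proof.
move=> oU.
pose box (q : (rat * rat) * (rat * rat)) : set (R * R) :=
  `]ratr q.1.1, ratr q.1.2[%classic `*` `]ratr q.2.1, ratr q.2.2[%classic.
have -> : U = \bigcup_(q in [set q | box q `<=` U]) box q.
  apply/seteqP; split => [x Ux|x [q /= qU /qU //]].
  move: oU; rewrite openE => /(_ _ Ux).
  rewrite /interior -nbhs_ballE => -[e /= e0 xeU].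
  have itv (z : R) : exists q : rat * rat,
      (ratr q.1 < z < ratr q.2) /\ z - e < ratr q.1 /\ ratr q.2 < z + e.
    have [p] := @rat_in_itvoo R (z - e) z (ltac:(lra)).
    have [q] := @rat_in_itvoo R z (z + e) (ltac:(lra)).
    rewrite !in_itv /= => /andP[zq qe] /andP[zp pz].
    by exists (p, q); rewrite /= pz zq.
  have [p [/andP[p1 p2] [p3 p4]]] := itv x.1.
  have [q [/andP[q1 q2] [q3 q4]]] := itv x.2.
  exists (p, q); last by split => /=; rewrite in_itv /=; apply/andP.
  move=> y [/= ]; rewrite !in_itv /= => /andP[y1 y2] /andP[y3 y4].
  by apply: xeU; split; rewrite /ball /= ltr_distl; apply/andP; split; lra.
rewrite bigcup_mkcond; apply: countable_bigcupT_measurable => [|q].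
  exact: countableP.
by case: ifPn => _ //; apply: measurableX; exact: measurable_itv.
Qed.

Lemma closed_measurable_plane A : closed A -> measurable (A : set (mplane R)).
Proof.
by move/closed_openC/open_measurable_plane/measurableC; rewrite setCK.
Qed.

Lemma continuous_measurable_plane (A : set (R * R)) (f : R * R -> R) :
  measurable (A : set (mplane R)) -> continuous f ->
  measurable_fun (A : set (mplane R)) (f : mplane R -> R).
Proof.
move=> mA /continuousP cf.
apply: (@measurable_funS _ _ _ _ setT) => //.
apply: (measurability _ (RGenOpens.measurableE R)).
move=> _ [_ [a [b ->] <-]]; rewrite setTI; apply: open_measurable_plane.
exact/cf/interval_open.
Qed.

Lemma continuous_affine (p q r : R) :
  continuous (fun x : R * R => p + q * x.1 + r * x.2).
Proof.
move=> x; apply: cvgD; last by apply: cvgM; [exact: cvg_cst|exact: cvg_snd].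
by apply: cvgD; [exact: cvg_cst|apply: cvgM; [exact: cvg_cst|exact: cvg_fst]].
Qed.

Lemma line_measurable (p q r : R) :
  measurable ([set x : R * R | p * x.1 + q * x.2 = r] : set (mplane R)).
Proof.
apply: closed_measurable_plane.
rewrite [X in closed X](_ : _ = (fun x : R * R => 0 + p * x.1 + q * x.2) @^-1` [set r]).
  apply: preimage_closed; last exact: closed_eq.
  by move=> x _; exact: continuous_affine.
by apply/seteqP; split => x /=; rewrite add0r.
Qed.

Lemma mu2X (A B : set (measurableTypeR R)) : measurable A -> measurable B ->
  mu2 (A `*` B : set (mplane R)) =
  (@lebesgue_measure R A * @lebesgue_measure R B)%E.
Proof. exact: product_measure1E. Qed.

Lemma line_null (p q r : R) : (p != 0) || (q != 0) ->
  mu2.-negligible [set x : R * R | p * x.1 + q * x.2 = r].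
Proof.
move=> pq; exists [set x : R * R | p * x.1 + q * x.2 = r]; split => //.
  exact: line_measurable.
(* A vertical line is the product of a point and an axis, of measure 0 * +oo = 0; any other line has
   one-point vertical sections, whose measures the product measure integrates. *)
have [q0|q0] := eqVneq q 0.
  have p0 : p != 0 by move: pq; rewrite q0 eqxx orbF.
  have -> : [set x : R * R | p * x.1 + q * x.2 = r] = [set r / p] `*` setT.
    apply/seteqP; split => -[x y] /=; rewrite q0 mul0r addr0.
      by move=> <-; split => //; field.
    by move=> [-> _]; field.
  transitivity ((@lebesgue_measure R [set (r / p)%R]) * (@lebesgue_measure R setT))%E.
    by apply: mu2X => //; exact: measurable_set1.
  by rewrite lebesgue_measure_set1 mul0e.
rewrite /mu2 /= /product_measure1 /=; apply: integral0_eq => x _.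
rewrite (_ : xsection _ _ = [set (r - p * x) / q]); last first.
  apply/seteqP; split => y /=; rewrite /xsection /= ?inE /=.
    by move=> <-; field.
  by move=> ->; field.
exact: lebesgue_measure_set1.
Qed.

(** The endpoints may coincide, since single points are later treated as degenerate segments; such a
    point lies on a vertical line. Otherwise the supporting line has normal [(q, - p)]. *)
Lemma segment_null (e : (R * R) * (R * R)) : mu2.-negligible (segment e).
Proof.
have [e12|e12] := eqVneq e.1 e.2.
  apply: (@negligibleS _ _ _ _ _ _ _ (@line_null 1 0 e.1.1 _)) => [x [s _ <-]|].
    rewrite /seg_pt /= e12 /= /GRing.scale /=; ring.
  by rewrite oner_eq0.
pose p := e.2.1 - e.1.1; pose q := e.2.2 - e.1.2.
apply: (@negligibleS _ _ _ _ _ _ _ (@line_null q (- p) (q * e.1.1 - p * e.1.2) _)).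
  move=> x [s _ <-]; rewrite /seg_pt /= /GRing.scale /= /p /q; ring.
rewrite oppr_eq0 /p /q !subr_eq0 -negb_and; apply: contra e12 => /andP[/eqP h1 /eqP h2].
by rewrite (surjective_pairing e.1) (surjective_pairing e.2) h1 h2.
Qed.

Lemma tri_compact a b c : compact (tri a b c).
Proof.
pose S := [set p : R * R | [/\ 0 <= p.1, 0 <= p.2 & p.1 + p.2 <= 1]].
pose g (p : R * R) : R * R := p.1 *: a + p.2 *: b + (1 - p.1 - p.2) *: c.
have -> : tri a b c = g @` S.
  apply/seteqP; split => x.
    move=> [r [s [t [r0 s0 t0 rst ->]]]]; exists (r, s); first by split => //=; lra.
    by rewrite /g /= (_ : 1 - r - s = t) //; lra.
  move=> [[r s] [/= r0 s0 rs] <-].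
  by exists r, s, (1 - r - s); split => //; lra.
apply: continuous_compact.
  apply: continuous_subspaceT => x.
  by apply: cvgD; [apply: cvgD|]; apply: cvgZr_tmp;
    [exact: cvg_fst|exact: cvg_snd|apply: cvgB; last exact: cvg_snd];
    apply: cvgB; [exact: cvg_cst|exact: cvg_fst].
have c01 := @segment_compact R 0 1.
apply: (subclosed_compact _ (compact_setX c01 c01)).
- have -> : S = [set p : R * R | 0 <= 0 + 1 * p.1 + 0 * p.2] `&`
     ([set p : R * R | 0 <= 0 + 0 * p.1 + 1 * p.2] `&` [set p : R * R | 0 <= 1 + -1 * p.1 + -1 * p.2]).
    apply/seteqP; split => p /=.
      by move=> [*]; do ! split; lra.
    by move=> [? [? ?]]; split; lra.
  have cl (p q r : R) : closed [set x : R * R | 0 <= p + q * x.1 + r * x.2].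
    apply: (@preimage_closed _ _ (fun x : R * R => p + q * x.1 + r * x.2) [set y | 0 <= y]).
      by move=> x _; exact: continuous_affine.
    exact: closed_ge.
  by apply: closedI => //; exact: closedI.
- by move=> p [*]; split => /=; rewrite in_itv /=; apply/andP; split; lra.
Qed.

End PlaneMeasure.

(** * Bounded polygonal domains: finite measure and null boundary *)

Section PolygonalDomain.
Context {R : realType}.
Variables (Omega : set (R * R)) (E : seq ((R * R) * (R * R))).
Hypothesis polO : polygonal_domain Omega E.

Lemma domain_box : exists r : R,
  closure Omega `<=` `[- r, r]%classic `*` `[- r, r]%classic.
Proof.
have [[_ _ _ [r Or]] _ _ _] := polO; exists r.
have cl : closed (`[- r, r]%classic `*` `[- r, r]%classic : set (R * R)).
  apply: compact_closed; first exact: norm_hausdorff.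
  by apply: compact_setX; exact: segment_compact.
move/closure_id: cl => ->; apply: closureS => x /Or.
rewrite /dist /= => dr.
have h (z w : R) : Num.sqrt ((0 - z) ^+ 2 + w) <= r -> 0 <= w -> - r <= z <= r.
  move=> zr w0; rewrite -ler_norml; apply: le_trans zr.
  rewrite -normrN -sqrtr_sqr; apply: ler_wsqrtr; rewrite sub0r; lra.
split; rewrite /= in_itv /=; first exact: (h _ _ dr (sqr_ge0 _)).
by rewrite addrC in dr; exact: (h _ _ dr (sqr_ge0 _)).
Qed.

Lemma domain_compact : compact (closure Omega).
Proof.
have [r Or] := domain_box; apply: (subclosed_compact _ _ Or).
  exact: closed_closure.
by apply: compact_setX; exact: segment_compact.
Qed.

Lemma domain_measurable : measurable (Omega : set (mplane R)).
Proof. by have [[oO _ _ _] _ _ _] := polO; exact: open_measurable_plane. Qed.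

(** Formulated for subsets of the closure because the mesh pieces are closed. *)
Lemma sub_domain_finite (A : set (R * R)) :
  measurable (A : set (mplane R)) -> A `<=` closure Omega ->
  (mu2 (A : set (mplane R)) < +oo)%E.
Proof.
move=> mA AO; have [r Or] := domain_box.
have mI : measurable (`[- r, r]%classic : set (measurableTypeR R)).
  exact: measurable_itv.
have mI2 : measurable (`[- r, r]%classic `*` `[- r, r]%classic : set (mplane R)).
  exact: measurableX.
apply: (@le_lt_trans _ _ (mu2 (`[- r, r]%classic `*` `[- r, r]%classic : set (mplane R)))).
  by apply: le_measure; rewrite ?inE //; exact: subset_trans Or.
rewrite mu2X //= lebesgue_measure_itv /=; case: ifP => _; last by rewrite mul0e.
by rewrite -EFinB -EFinM ltry.
Qed.

Lemma domain_finite : (mu2 (Omega : set (mplane R)) < +oo)%E.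
Proof.
by apply: sub_domain_finite; [exact: domain_measurable|exact: subset_closure].
Qed.

(** Test functions, their derivatives and the smooth approximants of a trace become square
    integrable, as the linearity of the integrals requires. *)
Lemma continuous_L2 (phi : R * R -> R) : continuous phi -> L2 Omega phi.
Proof.
move=> cphi.
have [M [_ /(_ (M + 1) _) Mphi]] : bounded_set (phi @` closure Omega).
  apply: compact_bounded; apply: continuous_compact domain_compact.
  exact: continuous_subspaceT.
apply: (@bounded_sq_integrable _ _ _ mu2 _ _ (M + 1)).
- exact: domain_measurable.
- exact: domain_finite.
- by apply: continuous_measurable_plane => //; exact: domain_measurable.
- move=> x Ox; apply: Mphi; first by rewrite ltrDl.
  by exists x => //; exact: subset_closure.
Qed.

Lemma negligible_bigcup_segment (s : seq ((R * R) * (R * R))) :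
  mu2.-negligible (\bigcup_(e in [set` s]) segment e).
Proof.
rewrite bigcup_seq; elim/big_ind: _ => [|A B|e _].
- exact: negligible_set0.
- exact: negligibleU.
- exact: segment_null.
Qed.

(** Averages divide by the area of a closed piece but integrate over its part in [Omega]. The two
    areas agree because the boundary consists of finitely many segments. *)
Lemma boundary_null : mu2.-negligible (closure Omega `\` Omega).
Proof.
have [[oO _ _ _] _ bO _] := polO.
have := negligible_bigcup_segment E; rewrite -bO /boundary.
by rewrite (interior_id _).1.
Qed.

End PolygonalDomain.

(** * Differences in H^1: weak derivatives and traces *)

Section H1Sub.
Context {R : realType}.
Implicit Types (phi psi : R * R -> R) (u v : h1 R).

Lemma CnB n phi psi : Cn n phi -> Cn n psi -> Cn n (phi - psi).
Proof.
elim: n phi psi => [|n ih] phi psi [cphi dphi] [cpsi dpsi].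
  by split => // x; apply: cvgB; [exact: cphi|exact: cpsi].
split; first by move=> x; apply: cvgB; [exact: cphi|exact: cpsi].
move=> v; have [df Df] := dphi v; have [dg Dg] := dpsi v; split.
  by move=> x; exact: derivableB.
rewrite (_ : (fun x => 'D_v (phi - psi) x) =
             ((fun x => 'D_v phi x) - (fun x => 'D_v psi x))); first exact: ih.
by apply/funext => x; rewrite deriveB.
Qed.

Lemma smoothB phi psi : smooth phi -> smooth psi -> smooth (phi - psi).
Proof. by move=> sphi spsi n; exact: CnB. Qed.

Lemma smooth_continuous phi : smooth phi -> continuous phi.
Proof. by move/(_ 0) => []. Qed.

Lemma smooth_derivable phi x w : smooth phi -> derivable phi x w.
Proof. by move/(_ 1) => [_ /(_ w)[]]. Qed.

Lemma smooth_continuous_derive phi w :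
  smooth phi -> continuous (fun x => 'D_w phi x).
Proof. by move/(_ 1) => [_ /(_ w)[_ []]]. Qed.

Definition h1_sub u v : h1 R :=
  H1 (fun x => fn u x - fn v x) (fun x => dx u x - dx v x)
     (fun x => dy u x - dy v x) (fun x => trace u x - trace v x).

Variables (Omega : set (R * R)) (E : seq ((R * R) * (R * R))).
Hypothesis polO : polygonal_domain Omega E.

Let mO := domain_measurable polO.
Let fO := domain_finite polO.

Lemma L2B (f g : R * R -> R) :
  L2 Omega f -> L2 Omega g -> L2 Omega (fun x => f x - g x).
Proof. exact: sq_integrableB. Qed.

Lemma weak_derivativeB w (f f' g g' : R * R -> R) :
  L2 Omega f -> L2 Omega f' -> L2 Omega g -> L2 Omega g' ->
  weak_derivative Omega w f g -> weak_derivative Omega w f' g' ->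
  weak_derivative Omega w (fun x => f x - f' x) (fun x => g x - g' x).
Proof.
move=> Lf Lf' Lg Lg' wf wf' phi tphi.
have Lphi := continuous_L2 polO (smooth_continuous tphi.1).
have LDphi := continuous_L2 polO (@smooth_continuous_derive _ w tphi.1).
transitivity (\int[mu2]_(x in Omega) (f x * 'D_w phi x) -
              \int[mu2]_(x in Omega) (f' x * 'D_w phi x)).
  rewrite -RintegralB //; [|exact: sq_integrableM..].
  by apply: eq_Rintegral => x _; rewrite mulrBl.
rewrite wf // wf' //.
transitivity (- (\int[mu2]_(x in Omega) (g x * phi x) -
                 \int[mu2]_(x in Omega) (g' x * phi x))); first by rewrite opprD.
rewrite -RintegralB //; [|exact: sq_integrableM..].
by congr (- _); apply: eq_Rintegral => x _; rewrite mulrBl.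
Qed.

Lemma side_dom_boundary (e : (R * R) * (R * R)) : e \in E ->
  side_dom (boundary Omega) e = [set s | 0 <= s <= 1].
Proof.
move=> eE; apply/seteqP; split => [s [] //|s /= s01]; split => //.
have [_ _ -> _] := polO; exists e => //=; by exists s.
Qed.

Lemma unit_itvE : [set s : R | 0 <= s <= 1] = `[0, 1]%classic.
Proof. by apply/seteqP; split => s /=; rewrite in_itv. Qed.

Lemma unit_itv_measurable : measurable ([set s | 0 <= s <= 1] : set (measurableTypeR R)).
Proof. by rewrite unit_itvE; exact: measurable_itv. Qed.

Lemma unit_itv_finite :
  (@lebesgue_measure R [set s | (0 <= s <= 1)%R] < +oo)%E.
Proof.
rewrite unit_itvE lebesgue_measure_itv /=; case: ifP => _ //.
by rewrite -EFinB ltry.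
Qed.

Lemma seg_pt_continuous (e : (R * R) * (R * R)) : continuous (seg_pt e).
Proof.
move=> s; apply: cvgD; apply: cvgZr_tmp; last exact: cvg_id.
by apply: cvgB; [exact: cvg_cst|exact: cvg_id].
Qed.

Let sideL2 (f : R -> R) :=
  sq_integrable (@lebesgue_measure R) [set s | 0 <= s <= 1] f.

Lemma continuous_side_L2 phi (e : (R * R) * (R * R)) : continuous phi ->
  sideL2 (fun s => phi (seg_pt e s)).
Proof.
move=> cphi.
have cf : continuous (fun s : R => phi (seg_pt e s)).
  move=> s; apply: continuous_comp; first exact: seg_pt_continuous.
  exact: cphi.
have [M [_ /(_ (M + 1) _) Mphi]] :
    bounded_set ((fun s : R => phi (seg_pt e s)) @` [set s | 0 <= s <= 1]).
  apply: compact_bounded; rewrite unit_itvE.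
  apply: continuous_compact; last exact: segment_compact.
  exact: continuous_subspaceT.
apply: (@bounded_sq_integrable _ _ _ _ _ _ (M + 1)).
- exact: unit_itv_measurable.
- exact: unit_itv_finite.
- apply: (@measurable_funS _ _ _ _ setT) => //.
  exact: continuous_measurable_fun.
- by move=> s s01; apply: Mphi; [rewrite ltrDl|exists s].
Qed.

Lemma trace_side_L2 u e : is_trace Omega E u -> e \in E ->
  sideL2 (fun s => trace u (seg_pt e s)).
Proof.
move=> [mu_ [iu _]] eE; split; first exact: mu_.
by have := iu _ eE; rewrite side_dom_boundary.
Qed.

Lemma sqrB_le (a b : R) : (a - b) ^+ 2 <= 2 * (a ^+ 2 + b ^+ 2).
Proof. have := sqr_ge0 (a + b); nra. Qed.

Lemma squeeze_sqrB (a b c : nat -> R) :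
  (forall n, 0 <= c n <= 2 * (a n + b n)) ->
  a @ \oo --> (0 : R) -> b @ \oo --> (0 : R) -> c @ \oo --> (0 : R).
Proof.
move=> cab a0 b0.
apply: (@squeeze_cvgr _ _ _ _ (fun=> 0) (fun n => 2 * (a n + b n))).
- by apply: nearW => n; exact: cab.
- exact: cvg_cst.
- by rewrite -[X in _ --> X](mulr0 2) -[X in 2 * X](addr0 0);
    apply: cvgM; [exact: cvg_cst|exact: cvgD].
Qed.

Lemma bd_integral_sqrB (f g : R * R -> R) :
  {in E, forall e, sideL2 (fun s => f (seg_pt e s))} ->
  {in E, forall e, sideL2 (fun s => g (seg_pt e s))} ->
  0 <= bd_integral E (boundary Omega) (fun x => (f x - g x) ^+ 2) <=
  2 * (bd_integral E (boundary Omega) (fun x => f x ^+ 2) +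
       bd_integral E (boundary Omega) (fun x => g x ^+ 2)).
Proof.
move=> Lf Lg; rewrite /bd_integral -big_split mulr_sumr /=.
apply/andP; split.
  apply: sumr_ge0 => e _; apply: mulr_ge0; first exact: sqrtr_ge0.
  by apply: Rintegral_ge0 => s _; exact: sqr_ge0.
rewrite big_seq [leRHS]big_seq; apply: ler_sum => e eE.
rewrite -mulrDr mulrCA; apply: ler_wpM2l; first exact: sqrtr_ge0.
rewrite side_dom_boundary //.
have mI := unit_itv_measurable.
have [_ if2] := Lf _ eE; have [_ ig2] := Lg _ eE.
have [_ ifg] := sq_integrableB mI (Lf _ eE) (Lg _ eE).
rewrite -RintegralD // -RintegralZl //; last exact: (integrableD mI if2 ig2).
apply: le_Rintegral => //.
  have := integrableZl mI 2 (integrableD mI if2 ig2).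
  by apply: eq_integrable => // s _; rewrite /= EFinM EFinD.
by move=> s _; exact: sqrB_le.
Qed.

(** Differences of the smooth approximants approximate the difference. The bound (a - b)^2 <= 2 (a^2
    + b^2) under the integral takes the place of the triangle inequality in L^2, both in the domain
    and on the boundary. *)
Lemma is_traceB u v : L2 Omega (fn u) -> L2 Omega (dx u) -> L2 Omega (dy u) ->
  L2 Omega (fn v) -> L2 Omega (dx v) -> L2 Omega (dy v) ->
  is_trace Omega E u -> is_trace Omega E v -> is_trace Omega E (h1_sub u v).
Proof.
move=> Lu Lux Luy Lv Lvx Lvy tu tv.
have Lt e : e \in E -> sideL2 (fun s => trace (h1_sub u v) (seg_pt e s)).
  by move=> eE; apply: sq_integrableB; [exact: unit_itv_measurable|
    exact: trace_side_L2..].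
split; first by move=> e /Lt[].
split; first by move=> e eE; rewrite side_dom_boundary //; have [] := Lt e eE.
have [_ [_ [phi [sphi [cphi bphi]]]]] := tu.
have [_ [_ [psi [spsi [cpsi bpsi]]]]] := tv.
exists (fun n => phi n - psi n); split; first by move=> n; exact: smoothB.
split; last first.
  apply: (squeeze_sqrB _ bphi bpsi) => n.
  have := @bd_integral_sqrB (fun x => phi n x - trace u x) (fun x => psi n x - trace v x).
  set c := bd_integral _ _ _.
  rewrite (_ : c = bd_integral E (boundary Omega)
     (fun x => ((phi n - psi n) x - trace (h1_sub u v) x) ^+ 2)); last first.
    by congr bd_integral; apply/funext => x; rewrite !fctE /=; ring.
  apply=> e eE; apply: sq_integrableB; (exact: unit_itv_measurable ||
    exact: trace_side_L2 || (apply: continuous_side_L2; exact: smooth_continuous)).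
have L n (w : h1 R) (th : nat -> R * R -> R) : (forall n, smooth (th n)) ->
    L2 Omega (fn w) -> L2 Omega (dx w) -> L2 Omega (dy w) ->
    [/\ L2 Omega (fun x => th n x - fn w x),
        L2 Omega (fun x => 'D_(1, 0) (th n) x - dx w x) &
        L2 Omega (fun x => 'D_(0, 1) (th n) x - dy w x)].
  move=> sth Lw Lwx Lwy; split; apply: L2B => //; apply: (continuous_L2 polO).
  - exact: smooth_continuous (sth n).
  - exact: smooth_continuous_derive (sth n).
  - exact: smooth_continuous_derive (sth n).
apply: (squeeze_sqrB _ cphi cpsi) => n.
have [p1 p2 p3] := L n u phi sphi Lu Lux Luy.
have [q1 q2 q3] := L n v psi spsi Lv Lvx Lvy.
have int3 (f g k : R * R -> R) : L2 Omega f -> L2 Omega g -> L2 Omega k ->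
    mu2.-integrable Omega (fun x => (f x ^+ 2 + g x ^+ 2 + k x ^+ 2)%:E).
  move=> [_ if2] [_ ig2] [_ ik2].
  exact: (integrableD mO (integrableD mO if2 ig2) ik2).
apply/andP; split.
  by apply: Rintegral_ge0 => x _; rewrite !addr_ge0 // sqr_ge0.
have ip := int3 _ _ _ p1 p2 p3; have iq := int3 _ _ _ q1 q2 q3.
rewrite -RintegralD // -RintegralZl //; last exact: (integrableD mO ip iq).
have DB x w : 'D_w (phi n - psi n) x = 'D_w (phi n) x - 'D_w (psi n) x.
  by rewrite deriveB //; exact: smooth_derivable.
apply: le_Rintegral => //.
- have := int3 _ _ _ (L2B p1 q1) (L2B p2 q2) (L2B p3 q3).
  apply: eq_integrable => // x _; rewrite /= !DB; congr EFin.
  rewrite /= (_ : (phi n - psi n) x = phi n x - psi n x) //; ring.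
- have := integrableZl mO 2 (integrableD mO ip iq).
  by apply: eq_integrable => // x _; rewrite /= EFinM EFinD.
- move=> x _; rewrite !DB.
  have -> : (phi n - psi n) x = phi n x - psi n x by [].
  have swap (a b c e : R) :
      (a - b - (c - e)) ^+ 2 <= 2 * ((a - c) ^+ 2 + (b - e) ^+ 2).
    by rewrite (_ : a - b - (c - e) = a - c - (b - e)) ?sqrB_le //; ring.
  have add3 (a a1 a2 b b1 b2 c c1 c2 : R) : a <= 2 * (a1 + a2) ->
      b <= 2 * (b1 + b2) -> c <= 2 * (c1 + c2) ->
      a + b + c <= 2 * (a1 + b1 + c1 + (a2 + b2 + c2)) by lra.
  by apply: add3; exact: swap.
Qed.

Lemma zero_traceB (G : set (R * R)) u v :
  zero_trace E G u -> zero_trace E G v -> zero_trace E G (h1_sub u v).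
Proof.
move=> zu zv e eE.
apply: (@filterS2 _ _ (@ae_filter_ringOfSetsType _ _ R (@lebesgue_measure R))
  _ _ _ _ (zu e eE) (zv e eE)) => s hu hv Gs /=.
by rewrite hu // hv // subrr.
Qed.

Lemma in_H1B u v : in_H1 Omega E u -> in_H1 Omega E v -> in_H1 Omega E (h1_sub u v).
Proof.
move=> [Lu Lux Luy [wux wuy] tu] [Lv Lvx Lvy [wvx wvy] tv]; split.
- exact: L2B.
- exact: L2B.
- exact: L2B.
- by split; exact: weak_derivativeB.
- exact: is_traceB.
Qed.

End H1Sub.

(** * Integrals of finite sums and integrals up to null sets *)

Section RintegralComplements.
Context {d : measure_display} {T : measurableType d} {R : realType}.
Variable mu : {measure set T -> \bar R}.
Implicit Types (A B D : set T) (f g : T -> R).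

Lemma Rintegral_sum D (I : Type) (s : seq I) (F : I -> T -> R) : measurable D ->
  (forall i, mu.-integrable D (fun x => (F i x)%:E)) ->
  \int[mu]_(x in D) (\sum_(i <- s) F i x) = \sum_(i <- s) \int[mu]_(x in D) F i x.
Proof.
move=> mD iF; elim: s => [|i s ih].
  rewrite big_nil; under eq_Rintegral do rewrite big_nil.
  by rewrite Rintegral_cst // mul0r.
rewrite big_cons -ih -RintegralD //; last first.
  have := integrable_sum mD s (P := xpredT) (fun i _ => iF i).
  by apply: eq_integrable => // x _; rewrite sumEFin.
- by exact: iF.
- by apply: eq_Rintegral => x _; rewrite big_cons; congr (_ + _).
Qed.

Lemma Rintegral_ae_subset A B f : measurable A -> measurable B -> A `<=` B ->
  mu.-negligible (B `\` A) -> mu.-integrable B (fun x => (f x)%:E) ->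
  \int[mu]_(x in A) f x = \int[mu]_(x in B) f x.
Proof.
move=> mA mB AB BA0 intf; rewrite /Rintegral; congr fine.
have mBA : measurable (B `\` A) by exact: measurableD.
rewrite [RHS](negligible_integral mBA) //.
  by rewrite setDD setIidr.
exact/negligibleP.
Qed.

Lemma ae_eq_Rintegral A f g : measurable A ->
  measurable_fun A f -> measurable_fun A g -> ae_eq mu A f g ->
  \int[mu]_(x in A) f x = \int[mu]_(x in A) g x.
Proof.
move=> mA mf mg fg; congr fine; apply: ae_eq_integral => //.
- exact/measurable_EFinP.
- exact/measurable_EFinP.
- by apply: filterS fg => x /[apply] /= ->.
Qed.

End RintegralComplements.

(** * Measurability of the pattern of sets containing a point *)

Section Mask.
Context {R : realType}.
Implicit Types (s : seq (set (R * R))) (x y : R * R).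

(* Which members of [s] contain [x]: the selected piece depends on [x] only
   through this finite amount of information. *)
Definition mask s x : seq bool := [seq `[< K x >] | K <- s].

Lemma measurable_mask s (bs : seq bool) :
  (forall K, K \in s -> measurable (K : set (mplane R))) ->
  measurable ([set x | mask s x = bs] : set (mplane R)).
Proof.
elim: s bs => [|K s ih] [|b bs] mS.
- by rewrite (_ : [set x | _] = setT) //; apply/seteqP; split.
- by rewrite (_ : [set x | _] = set0) //; apply/seteqP; split.
- by rewrite (_ : [set x | _] = set0) //; apply/seteqP; split.
have mK : measurable (K : set (mplane R)) by apply: mS; rewrite mem_head.
have ms := ih bs (fun L Ls => mS L (mem_behead (s := K :: s) Ls)).
rewrite (_ : [set x | _] = (if b then K else ~` K) `&` [set x | mask s x = bs]).
  by apply: measurableI => //; case: b => //; exact: measurableC.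
apply/seteqP; split => x /=.
  by move=> [<- ->]; split => //; case: asboolP.
by case: b => -[Kx ->]; congr cons; [exact/asboolP|exact/asboolPn].
Qed.

Lemma mask_mem s x y : mask s x = mask s y ->
  forall K, K \in s -> (K x <-> K y).
Proof.
elim: s => // L s ih [Lxy sxy] K; rewrite inE => /orP[/eqP ->|]; last exact: ih.
by split => /asboolP Lz; apply/asboolP; rewrite ?Lxy // -Lxy.
Qed.

End Mask.

(** * Piecewise means: measurability, linearity, orthogonality *)

Section Smoothing.
Context {R : realType}.
Variables (Omega : set (R * R)) (E : seq ((R * R) * (R * R))).
Hypothesis polO : polygonal_domain Omega E.
Variable S : set (set (R * R)).
Hypothesis finS : finite_set S.
Hypothesis mS : forall K, S K -> measurable (K : set (mplane R)).
Hypothesis sub_S : forall K, S K -> K `<=` closure Omega.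
Implicit Types (f tau : R * R -> R) (eps sig : field3 R).

Let mO : measurable (Omega : set (mplane R)) := domain_measurable polO.
Let fO : (mu2 (Omega : set (mplane R)) < +oo)%E := domain_finite polO.

Lemma piece_measurable x : measurable (piece_at S x : set (mplane R)).
Proof. by rewrite /piece_at; case: xgetP => [K _ [/mS]|_]. Qed.

(** [piece_at] rests on an arbitrary choice, yet it is constant wherever [mask] is. Masks form a
    countable type, so every preimage is a countable union of measurable sets. The list is duplicate
    free for the later sums over pieces. *)
Lemma piece_at_fibers : exists s : seq (set (R * R)),
  [/\ uniq s, S = [set` s] &
  forall P : set (set (R * R)),
    measurable ([set x | P (piece_at S x)] : set (mplane R))].
Proof.
have [s0 Ss0] := (finite_seqP _).1 finS; exists (undup s0); split.
- exact: undup_uniq.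
- by rewrite Ss0; apply/seteqP; split => K /=; rewrite mem_undup.
move=> P.
have pieceE x y : mask s0 x = mask s0 y -> piece_at S x = piece_at S y.
  move=> mxy; have xy := mask_mem mxy; rewrite /piece_at; congr xget.
  apply/seteqP; split => K /= [SK Kx]; split => //;
    have Ks : K \in s0 by move: SK; rewrite Ss0.
  - exact: (xy K Ks).1.
  - exact: (xy K Ks).2.
have -> : [set x | P (piece_at S x)] =
  \bigcup_(bs in [set mask s0 x | x in [set x | P (piece_at S x)]])
     [set x | mask s0 x = bs].
  apply/seteqP; split => [x Px|x [_ [y Py <-] /= /pieceE ->] //].
  by exists (mask s0 x) => //; exists x.
rewrite bigcup_mkcond; apply: countable_bigcupT_measurable.
  exact: countableP.
move=> bs; case: ifP => // _; apply: measurable_mask => K Ks.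
by apply: mS; rewrite Ss0.
Qed.

Lemma L2_piece_at (F : set (R * R) -> R) : L2 Omega (fun x => F (piece_at S x)).
Proof.
have [s [_ Ss mP]] := piece_at_fibers.
(* The term with [set0] covers the points in no piece, where [xget] returns its default. *)
apply: (@bounded_sq_integrable _ _ _ _ _ _ (`|F set0| + \sum_(K <- s) `|F K|)) => //.
  move=> _ B mB; apply: measurableI => //; exact: (mP (F @^-1` B)).
move=> x _; rewrite /piece_at; case: xgetP => [K _ [SK _]|_]; last first.
  by rewrite lerDl sumr_ge0.
have Ks : K \in s by rewrite Ss in SK.
rewrite (big_rem _ Ks) /= addrCA lerDl addr_ge0 // sumr_ge0 //.
Qed.

Lemma in_W_piecewise_mean eps : in_W Omega (piecewise_mean Omega S eps).
Proof. by move=> i; exact: (L2_piece_at (fun K => average Omega eps K i 0)). Qed.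

(** The identity holds at every point, because the chosen piece does not depend on the field;
    iterated smoothing thus respects differences without exceptional sets. *)
Lemma piecewise_meanB eps sig x : in_W Omega eps -> in_W Omega sig ->
  piecewise_mean Omega S (fun y => eps y - sig y) x =
  piecewise_mean Omega S eps x - piecewise_mean Omega S sig x.
Proof.
move=> Weps Wsig; rewrite /piecewise_mean /average.
have mK := piece_measurable x; set K := piece_at S x in mK *.
have mKO : measurable (K `&` Omega : set (mplane R)) by exact: measurableI.
have int (tau : field3 R) i : in_W Omega tau ->
    mu2.-integrable (K `&` Omega) (fun y => (tau y i 0)%:E).
  move=> Wtau; apply: (integrableS mO) => //.
  by apply: sq_integrable_integrable => //; exact: Wtau.
apply/colP => i; rewrite !mxE -mulrBr; congr (_ * _).
rewrite -RintegralB //; [|exact: int..].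
by apply: eq_Rintegral => y _; rewrite !mxE.
Qed.

Hypothesis cov_S : Omega `<=` \bigcup_(K in S) K.
Hypothesis null_S : forall K L, S K -> S L -> K <> L -> mu2.-negligible (K `&` L).

Lemma piece_at_mem x : Omega x -> S (piece_at S x) /\ piece_at S x x.
Proof.
move=> /cov_S[K SK Kx].
by apply: (@xgetPex _ _ [set K | S K /\ K x]); exists K.
Qed.

Definition scalar_mean f (K : set (R * R)) : R :=
  (fine (mu2 K))^-1 * \int[mu2]_(y in K `&` Omega) f y.

(** The points that chose [K] differ from [K] only by overlaps and boundary points. There [tau] is
    almost everywhere a constant, which multiplies the integral of [f] minus its mean times the area
    of [K]. *)
Lemma piece_orthogonal f tau K : S K -> L2 Omega f -> L2 Omega tau ->
  (exists c, {ae mu2, forall x, Omega x -> K x -> tau x = c}) ->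
  \int[mu2]_(x in Omega `&` [set x | piece_at S x = K])
     (tau x * (f x - scalar_mean f (piece_at S x))) = 0.
Proof.
move=> SK Lf Ltau [c tauc]; have [s [_ Ss mP]] := piece_at_fibers.
set A := Omega `&` _.
have mA : measurable (A : set (mplane R)).
  by apply: measurableI => //; exact: (mP [set K]).
have mK := mS SK.
have mKO : measurable (K `&` Omega : set (mplane R)) by exact: measurableI.
have AKO : A `<=` K `&` Omega.
  by move=> x [Ox /= xK]; split => //; have [_] := piece_at_mem Ox; rewrite xK.
(* A point of [K] that is lost chose another piece, hence lies in an overlap. *)
have AKO0 : mu2.-negligible ((K `&` Omega) `\` A).
  have B0 : mu2.-negligible (\big[setU/set0]_(L <- s | L != K) (K `&` L)).
    rewrite big_seq_cond; elim/big_rec: _ => [|L B /andP[Ls LK] B0].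
      exact: negligible_set0.
    apply: negligibleU => //; apply: null_S => //; first by rewrite Ss.
    by move=> KL; rewrite KL eqxx in LK.
  apply: (negligibleS _ B0) => x [[Kx Ox] nA].
  have [Sx xx] := piece_at_mem Ox.
  rewrite -bigcup_seq_cond; exists (piece_at S x) => //=.
  have -> /= : piece_at S x \in s by move: Sx; rewrite {1}Ss.
  by apply/eqP => xK; exact: nA.
have Lfs := sq_integrable_integrable mO fO Lf.
have ifA : mu2.-integrable A (fun x => (f x)%:E).
  by apply: (integrableS mO) Lfs => // x [].
have fA : (mu2 (A : set (mplane R)) < +oo)%E.
  by apply: le_lt_trans fO; apply: le_measure; rewrite ?inE // => x [].
have mtau : measurable_fun A (tau : mplane R -> R).
  by apply: measurable_funS Ltau.1 => // x [].
transitivity (\int[mu2]_(x in A) (c * (f x - scalar_mean f K))).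
  have mf : measurable_fun A (f : mplane R -> R).
    by apply: measurable_funS Lf.1 => // x [].
  transitivity (\int[mu2]_(x in A) (tau x * (f x - scalar_mean f K))).
    by apply: eq_Rintegral => x; rewrite inE => -[_ /= ->].
  apply: ae_eq_Rintegral => //.
  - by apply: measurable_funM => //; apply: measurable_funB.
  - by apply: measurable_funM => //; apply: measurable_funB.
  - apply: (@filterS _ _ (@ae_filter_ringOfSetsType _ _ R (@mu2 R)) _ _ _ tauc).
    by move=> x tx Ax /=; have [Kx Ox] := AKO x Ax; rewrite tx.
have icst r : mu2.-integrable A (fun=> r%:E) by exact: integrable_cstr.
rewrite RintegralZl //; last exact: (integrableB mA ifA (icst _)).
rewrite (RintegralB mA ifA (icst _)) Rintegral_cst //.
have ifKO : mu2.-integrable (K `&` Omega) (fun x => (f x)%:E).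
  by apply: (integrableS mO) Lfs => // x [].
have -> : fine (mu2 A) = fine (mu2 K).
  have cst1 (B : set (mplane R)) : measurable B -> fine (mu2 B) = \int[mu2]_(x in B) 1.
    by move=> mB; rewrite Rintegral_cst // mul1r.
  have fK : (mu2 (K : set (mplane R)) < +oo)%E.
    by apply: (sub_domain_finite polO) => //; exact: sub_S.
  rewrite !cst1 //; apply: Rintegral_ae_subset => //; last exact: integrable_cstr.
    by move=> x /AKO[].
  have := negligibleU AKO0 (boundary_null polO); apply: negligibleS.
  move=> x [Kx nA]; have [Ox|nO] := pselect (Omega x); first by left.
  by right; split => //; exact: sub_S Kx.
rewrite (Rintegral_ae_subset mA mKO AKO AKO0 ifKO) /scalar_mean.
(* On a piece of area 0 the inverse is 0 by convention, so the mean is 0; the integral of [f] is 0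
   as well. *)
have [K0|K0] := eqVneq (fine (mu2 K)) 0; last by field.
have muKO : mu2 (K `&` Omega : set (mplane R)) = 0.
  apply/eqP; rewrite -measure_le0.
  have fK : (mu2 (K : set (mplane R)) < +oo)%E.
    by apply: (sub_domain_finite polO) => //; exact: sub_S.
  have -> : 0%E = mu2 (K : set (mplane R)).
    by rewrite -[RHS]fineK ?ge0_fin_numE // K0.
  by apply: le_measure; rewrite ?inE // => x [].
rewrite /Rintegral (null_set_integral mKO _ muKO); last first.
  exact: measurable_int ifKO.
by rewrite /= K0 !(mulr0, subr0).
Qed.

Lemma scalar_mean_orthogonal f tau : L2 Omega f -> L2 Omega tau ->
  (forall K, S K -> exists c, {ae mu2, forall x, Omega x -> K x -> tau x = c}) ->
  \int[mu2]_(x in Omega) (tau x * (f x - scalar_mean f (piece_at S x))) = 0.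
Proof.
move=> Lf Ltau ctau; have [s [us Ss mP]] := piece_at_fibers.
pose g x := tau x * (f x - scalar_mean f (piece_at S x)).
have ig : mu2.-integrable Omega (fun x => (g x)%:E).
  apply: sq_integrableM => //; apply: sq_integrableB => //.
  exact: L2_piece_at.
pose A K := [set x | piece_at S x = K].
have mA K : measurable (A K : set (mplane R)) by exact: (mP [set K]).
(* Unlike the pieces, the sets [A K] are disjoint: at a point of [Omega] only the summand of its
   chosen piece can be nonzero. *)
transitivity (\int[mu2]_(x in Omega) (\sum_(K <- s) (g \_ (A K)) x)).
  apply: eq_Rintegral => x; rewrite inE => Ox.
  have [Sx _] := piece_at_mem Ox.
  have xs : piece_at S x \in s by move: Sx; rewrite {1}Ss.
  rewrite (bigD1_seq _ xs us) /= big1_seq ?addr0; last first.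
    move=> K /andP[Kx _]; rewrite patchE memNset // => xK.
    by rewrite -xK eqxx in Kx.
  by rewrite patchE mem_set.
rewrite Rintegral_sum //; last first.
  move=> K.
  rewrite (_ : (fun x => ((g \_ (A K)) x)%:E) = (EFin \o g) \_ (A K)); last first.
    by rewrite restrict_EFin.
  apply: (integrable_restrict mu2 (mA K) mO (EFin \o g)).1.
  by apply: (integrableS mO) ig => //; exact: measurableI.
apply: big1_seq => K /andP[_ Ks]; rewrite -Rintegral_mkcondr.
have SK : S K by rewrite Ss.
exact: (piece_orthogonal SK Lf Ltau (ctau _ SK)).
Qed.

Lemma piecewise_mean_orthogonal eps sig : in_W Omega eps -> in_Wh Omega S sig ->
  pairing Omega sig (fun x => eps x - piecewise_mean Omega S eps x) = 0.
Proof.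
move=> Weps [Wsig csig]; rewrite /pairing /ddot.
pose F i x := sig x i 0 * (eps x i 0 - piecewise_mean Omega S eps x i 0).
have iF i : mu2.-integrable Omega (fun x => (F i x)%:E).
  apply: sq_integrableM => //; first exact: Wsig.
  apply: sq_integrableB => //; first exact: Weps.
  exact: in_W_piecewise_mean.
transitivity (\int[mu2]_(x in Omega) (\sum_i F i x)).
  by apply: eq_Rintegral => x _; apply: eq_bigr => i _; rewrite /F !mxE.
rewrite Rintegral_sum //; apply: big1 => i _.
rewrite -[RHS](@scalar_mean_orthogonal (fun x => eps x i 0) (fun x => sig x i 0)).
- by apply: eq_Rintegral => x _; rewrite /F /piecewise_mean /average mxE.
- exact: Weps.
- exact: Wsig.
move=> K /csig[c sc]; exists (c i 0).
apply: (@filterS _ _ (@ae_filter_ringOfSetsType _ _ R (@mu2 R)) _ _ _ sc).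
by move=> x sx Ox Kx; rewrite sx.
Qed.

End Smoothing.

(** * Overlaps of triangles with a common vertex *)

Section Triangles.
Context {R : realType}.
Implicit Types a b c d x : R * R.

Lemma tri_measurable a b c : measurable (tri a b c : set (mplane R)).
Proof.
apply: closed_measurable_plane; apply: compact_closed.
  exact: norm_hausdorff.
exact: tri_compact.
Qed.

Lemma negligible_fin_bigcup (I : choiceType) (D : set I) (F : I -> set (R * R)) :
  finite_set D -> (forall i, D i -> mu2.-negligible (F i)) ->
  mu2.-negligible (\bigcup_(i in D) F i).
Proof.
move=> /finite_seqP[s ->] F0; rewrite bigcup_seq big_seq.
elim/big_rec: _ => [|i B si B0]; first exact: negligible_set0.
by apply: negligibleU => //; exact: F0.
Qed.

(** Both values are [orient c a b] times a barycentric weight of [x]: the triangle lies in the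
    sector at [c] between the rays through [a] and [b]. *)
Lemma tri_orient a b c x : 0 <= orient c a b -> tri c a b x ->
  0 <= orient c a x /\ 0 <= orient c x b.
Proof.
move=> o [r [s [t [r0 s0 t0 rst ->]]]].
have rE : r = 1 - s - t by lra.
have -> : orient c a (r *: c + s *: a + t *: b) = t * orient c a b.
  by rewrite /orient /= rE /GRing.scale /=; ring.
have -> : orient c (r *: c + s *: a + t *: b) b = s * orient c a b.
  by rewrite /orient /= rE /GRing.scale /=; ring.
by split; exact: mulr_ge0.
Qed.

(** The two sectors lie on opposite sides of the line through [c] and [b], whose equation is
    [orient c b x = 0]. *)
Lemma adjacent_tri_null a b d c : 0 < orient c a b -> 0 < orient c b d ->
  mu2.-negligible (tri c a b `&` tri c b d).
Proof.
move=> o o'.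
have h : (- (b.2 - c.2) != 0) || (b.1 - c.1 != 0).
  rewrite -negb_and; apply/negP => /andP[/eqP h1 /eqP h2].
  move: o; rewrite /orient h2 (_ : b.2 - c.2 = 0) ?mulr0 ?mul0r ?subrr ?ltxx //.
  by lra.
apply: (negligibleS _ (@line_null R _ _ (- (b.2 - c.2) * c.1 + (b.1 - c.1) * c.2) h)).
move=> x [/(tri_orient (ltW o))[_ h1] /(tri_orient (ltW o'))[h2 _]] /=.
move: h1 h2; rewrite /orient; lra.
Qed.

(* The cross products of the four vectors from the barycenter to the nodes
   satisfy linear relations, since the vectors sum to zero. *)
Lemma opposite_tri_null a0 a1 a2 a3 c :
  c = 4%:R^-1 *: (a0 + a1 + a2 + a3) ->
  0 < orient c a0 a1 -> 0 < orient c a1 a2 ->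
  0 < orient c a2 a3 -> 0 < orient c a3 a0 ->
  mu2.-negligible (tri c a0 a1 `&` tri c a2 a3).
Proof.
move=> cE p0 q0 r0 s0.
apply: (negligibleS _ (segment_null (c, c))) => x [x01 [z [u [v [z0 u0 v0 zuv xE]]]]].
have [h1 h2] := tri_orient (ltW p0) x01.
have c1 : 4%:R * c.1 = a0.1 + a1.1 + a2.1 + a3.1 by rewrite cE /= /GRing.scale /=; field.
have c2 : 4%:R * c.2 = a0.2 + a1.2 + a2.2 + a3.2 by rewrite cE /= /GRing.scale /=; field.
have zE : z = 1 - u - v by lra.
pose p := orient c a0 a1; pose q := orient c a1 a2.
pose s := orient c a3 a0.
have {}h1 : 0 <= u * (s - p) - v * s.
  move: h1; rewrite xE /s /p /orient /= /GRing.scale /= zE.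
  have -> : a3.1 = 4%:R * c.1 - a0.1 - a1.1 - a2.1 by lra.
  have -> : a3.2 = 4%:R * c.2 - a0.2 - a1.2 - a2.2 by lra.
  lra.
have {}h2 : 0 <= - (u * q) + v * (q - p).
  move: h2; rewrite xE /q /p /orient /= /GRing.scale /= zE.
  have -> : a3.1 = 4%:R * c.1 - a0.1 - a1.1 - a2.1 by lra.
  have -> : a3.2 = 4%:R * c.2 - a0.2 - a1.2 - a2.2 by lra.
  lra.
(* Weighting the two inequalities by [q] and [s] cancels the terms in [q * s]. The remaining
   coefficients are positive and force [u = v = 0], so the triangles meet only in [c]. *)
have uv0 : u * (q * p) + v * (s * p) <= 0.
  have := mulr_ge0 (ltW q0) h1; have := mulr_ge0 (ltW s0) h2.
  by rewrite -/q -/s; lra.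
have uqp : 0 <= u * (q * p) by rewrite !mulr_ge0 // ltW.
have vsp : 0 <= v * (s * p) by rewrite !mulr_ge0 // ltW.
have u00 : u = 0.
  have /eqP : u * (q * p) = 0 by lra.
  by rewrite mulf_eq0 (gt_eqF (mulr_gt0 q0 p0)) orbF => /eqP.
have v00 : v = 0.
  have /eqP : v * (s * p) = 0 by lra.
  by rewrite mulf_eq0 (gt_eqF (mulr_gt0 s0 p0)) orbF => /eqP.
exists 0; rewrite /= ?lexx ?ler01 // /seg_pt /= xE zE u00 v00.
by rewrite !subr0 !scale0r !addr0.
Qed.

End Triangles.

(** * Elements, meshes and the two auxiliary subdivisions *)

Lemma sum_ord4 (V : zmodType) (a : 'I_4 -> V) (i : 'I_4) :
  \sum_j a j = a i + a (ordS i) + a (ordS (ordS i)) + a (ordS (ordS (ordS i))).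
Proof.
have aE j : a j = a (inord j) by rewrite inord_val.
under eq_bigr do rewrite aE.
rewrite !big_ord_recl big_ord0 addr0 (aE i) (aE (ordS i)) (aE (ordS (ordS i)))
  (aE (ordS (ordS (ordS i)))) /=.
case: i => [[|[|[|[|//]]]] ?] /=; rewrite !addrA.
- by [].
- by rewrite [LHS](ACl (2*3*4*1)).
- by rewrite [LHS](ACl (3*4*1*2)).
- by rewrite [LHS](ACl (4*1*2*3)).
Qed.

Section Mesh.
Context {k : element_kind} {R : realType}.
Local Notation n := (nnodes k).
Implicit Types (T : element k R) (i j : 'I_n).

(** In cyclic order two distinct subtriangles are neighbors, separated by the line through the
    center and a common node, or opposite ones in a quadrilateral. As the latter may be nonconvex,
    this case relies on the center being the average of the nodes. *)
Lemma subtri_null T i j : proper_element T -> i != j ->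
  mu2.-negligible (subtri T i `&` subtri T j).
Proof.
move=> pT.
have adj l : mu2.-negligible (subtri T l `&` subtri T (ordS l)).
  exact: adjacent_tri_null.
have adj' l : mu2.-negligible (subtri T (ordS l) `&` subtri T l).
  by rewrite setIC.
have H : [\/ i = j, j = ordS i, i = ordS j |
    [/\ k = Quadrilateral, j = ordS (ordS i) & i = ordS (ordS j)]].
  clear; case: k i j => /= i j.
    case: i j => [[|[|[|//]]] ?] [[|[|[|//]]] ?];
      (by constructor 1; apply/val_inj) || (by constructor 2; apply/val_inj) ||
      (by constructor 3; apply/val_inj).
  case: i j => [[|[|[|[|//]]]] ?] [[|[|[|[|//]]]] ?];
      (by constructor 1; apply/val_inj) || (by constructor 2; apply/val_inj) ||
      (by constructor 3; apply/val_inj) ||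
      (by constructor 4; split => //; apply/val_inj).
case: H => [-> /eqP //|-> _|-> _|[kQ ji ij] _] //.
rewrite ji /subtri.
apply: opposite_tri_null => //.
- rewrite /Defs.center; clear -kQ; move: T i; rewrite kQ /= => T i; congr (_ *: _).
  exact: sum_ord4.
(* The chain of orientations closes up: the fourth successor of [i] is [i]. *)
- have := pT (ordS (ordS (ordS i))).
  by have -> : ordS (ordS (ordS (ordS i))) = i by rewrite -ji -ij.
Qed.

(** The halves refine both auxiliary subdivisions, so overlaps of node pieces reduce to overlaps of
    subtriangles; [true] marks the half at the second node of the edge. *)
Definition half_subtri T i (b : bool) : set (R * R) :=
  if b then tri (Defs.center T) (midpoint T i) (node T (ordS i))
  else tri (Defs.center T) (node T i) (midpoint T i).

Lemma node_pieceE T i :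
  node_piece T i = half_subtri T i true `|` half_subtri T (ordS i) false.
Proof. by []. Qed.

Lemma subtri_halves T i :
  subtri T i = half_subtri T i false `|` half_subtri T i true.
Proof.
rewrite /half_subtri /midpoint /seg_pt /=; apply/seteqP; split => x.
  (* The larger of the two node weights decides the half: twice the smaller one goes to the
     midpoint, and the difference stays at the node. *)
  move=> [r [s [t [r0 s0 t0 rst ->]]]]; have [st|ts] := leP t s; [left|right].
    exists r, (s - t), (2 * t); split; [lra..|].
    by apply: injective_projections; rewrite /= /GRing.scale /=; lra.
  exists r, (2 * s), (t - s); split; [lra..|].
  by apply: injective_projections; rewrite /= /GRing.scale /=; lra.
move=> [] [r [s [t [r0 s0 t0 rst ->]]]].
  exists r, (s + t / 2), (t / 2); split; [lra..|].
  by apply: injective_projections; rewrite /= /GRing.scale /=; lra.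
exists r, (s / 2), (t + s / 2); split; [lra..|].
by apply: injective_projections; rewrite /= /GRing.scale /=; lra.
Qed.

Lemma half_subtri_sub T i b : half_subtri T i b `<=` subtri T i.
Proof. by rewrite subtri_halves; case: b; [right|left]. Qed.

Lemma half_subtri_measurable T i b :
  measurable (half_subtri T i b : set (mplane R)).
Proof. by case: b; exact: tri_measurable. Qed.

Lemma half_subtri_null T i : proper_element T ->
  mu2.-negligible (half_subtri T i true `&` half_subtri T i false).
Proof.
move=> /(_ i) o; rewrite setIC.
have h1 : orient (Defs.center T) (node T i) (midpoint T i) =
    2^-1 * orient (Defs.center T) (node T i) (node T (ordS i)).
  by rewrite /orient /midpoint /seg_pt /= /GRing.scale /=; lra.
have h2 : orient (Defs.center T) (midpoint T i) (node T (ordS i)) =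
    2^-1 * orient (Defs.center T) (node T i) (node T (ordS i)).
  by rewrite /orient /midpoint /seg_pt /= /GRing.scale /=; lra.
by apply: adjacent_tri_null; rewrite (h1, h2) mulr_gt0 // invr_gt0.
Qed.

Lemma region_subtri T i : subtri T i `<=` region T.
Proof. by move=> x Tx; exists i. Qed.

Variables (Omega : set (R * R)) (M : seq (element k R)).
Hypothesis subM : subdivision_of Omega M.

Lemma mesh_cover : \bigcup_(T in [set` M]) region T = closure Omega.
Proof. by have [] := subM. Qed.

Lemma mesh_proper T : T \in M -> proper_element T.
Proof. by have [_ + _ _] := subM; exact. Qed.

Lemma region_closure T : T \in M -> region T `<=` closure Omega.
Proof. by move=> TM x Tx; rewrite -mesh_cover; exists T. Qed.

Lemma conforming_null T T' : T \in M -> T' \in M -> T != T' ->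
  mu2.-negligible (region T `&` region T').
Proof.
move=> TM TM' TT'; have [_ _ _ /(_ _ _ TM TM' TT')] := subM.
case=> [->|[i [j [_ ->]]]|[i [j [_ ->]]]].
- exact: negligible_set0.
- apply: (negligibleS _ (segment_null (node T i, node T i))) => x /= ->.
  exists 0; rewrite /= ?lexx ?ler01 // /seg_pt /=.
  by rewrite scale0r addr0 subr0 scale1r.
- exact: segment_null.
Qed.

Lemma mesh_subtri_null T T' i j : T \in M -> T' \in M -> (T, i) != (T', j) ->
  mu2.-negligible (subtri T i `&` subtri T' j).
Proof.
move=> TM TM'; have [<-{TM' T'}|TT' _] := eqVneq T T'.
  rewrite xpair_eqE eqxx /=; exact: subtri_null (mesh_proper TM).
apply: negligibleS (conforming_null TM TM' TT') => x [Tx Tx'].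
by split; apply: region_subtri; eassumption.
Qed.

Lemma mesh_half_null T T' i j b b' : T \in M -> T' \in M ->
  (T, i, b) != (T', j, b') ->
  mu2.-negligible (half_subtri T i b `&` half_subtri T' j b').
Proof.
move=> TM TM'; have [[<- <-]{TM' T' j}|Tij _] := eqVneq (T, i) (T', j).
  rewrite xpair_eqE eqxx /=; have := half_subtri_null i (mesh_proper TM).
  by case: b; case: b' => //; rewrite setIC.
apply: negligibleS (mesh_subtri_null TM TM' Tij) => x [Tx Tx'].
by split; apply: half_subtri_sub; eassumption.
Qed.

Lemma finite_mesh_indexed (F : element k R -> 'I_n -> set (R * R)) :
  finite_set [set K | exists T i, T \in M /\ K = F T i].
Proof.
apply: (@sub_finite_set _ _ ((fun p => F p.1 p.2) @` ([set` M] `*` [set: 'I_n]))).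
  by move=> K [T [i [TM ->]]]; exists (T, i).
by apply: finite_image; apply: finite_setX => //; exact: finite_finset.
Qed.

Lemma T1h_finite : finite_set (T1h M).
Proof. exact: finite_mesh_indexed. Qed.

Lemma T2h_finite : finite_set (T2h M).
Proof. exact: finite_mesh_indexed. Qed.

Lemma T2h_measurable K : T2h M K -> measurable (K : set (mplane R)).
Proof.
move=> [T [i [_ ->]]]; rewrite node_pieceE.
by apply: measurableU; exact: half_subtri_measurable.
Qed.

Lemma T2h_sub K : T2h M K -> K `<=` closure Omega.
Proof.
move=> [T [i [TM ->]]]; rewrite node_pieceE => x Kx.
by apply: (region_closure TM); case: Kx => /half_subtri_sub /region_subtri.
Qed.

Lemma mesh_subtri_cover x : Omega x -> exists T i, T \in M /\ subtri T i x.
Proof.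
move=> /subset_closure; rewrite -mesh_cover => -[T TM [i _ Tx]].
by exists T, i.
Qed.

Lemma T2h_cover : Omega `<=` \bigcup_(K in T2h M) K.
Proof.
move=> x /mesh_subtri_cover[T [i [TM]]]; rewrite subtri_halves => -[] Tx.
  (* The node piece of index [i] surrounds the second node of edge [i], so the half at the first
     node belongs to the preceding index. *)
  exists (node_piece T (ord_pred i)); first by exists T, (ord_pred i).
  by rewrite node_pieceE ord_predK; right.
exists (node_piece T i); first by exists T, i.
by rewrite node_pieceE; left.
Qed.

Lemma T2h_null K L : T2h M K -> T2h M L -> K <> L -> mu2.-negligible (K `&` L).
Proof.
move=> [T [i [TM ->]]] [T' [j [TM' ->]]] KL.
have Tij : (T, i) != (T', j) by apply: contra_notN KL => /eqP[<- <-].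
have Tij' : (T, ordS i) != (T', ordS j).
  by apply: contra Tij; rewrite !xpair_eqE (inj_eq (@ordS_inj _)).
(* Of the four overlaps, two pair halves with equal Booleans, whose indices still differ as [ordS]
   is injective; the other two differ in the Boolean. *)
rewrite !node_pieceE setIUl !setIUr.
apply: negligibleU; apply: negligibleU; apply: mesh_half_null => //;
  by rewrite xpair_eqE (negPf Tij, negPf Tij', andbF).
Qed.

Lemma T1h_measurable K : T1h M K -> measurable (K : set (mplane R)).
Proof.
move=> [T [i [_ ->]]].
rewrite (_ : edge_patch M T i = \bigcup_(p in [set p : element k R * 'I_n |
    p.1 \in M /\ segment (edge p.1 p.2) = segment (edge T i)]) subtri p.1 p.2).
  apply: fin_bigcup_measurable => [|p _]; last exact: tri_measurable.
  apply: (@sub_finite_set _ _ ([set` M] `*` [set: 'I_n])).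
    by move=> p [pM _]; split.
  by apply: finite_setX => //; exact: finite_finset.
apply/seteqP; split => x.
  by move=> [T' [j [TM' ee Tx]]]; exists (T', j).
by move=> [[T' j] /= [TM' ee] Tx]; exists T', j.
Qed.

Lemma T1h_sub K : T1h M K -> K `<=` closure Omega.
Proof.
move=> [T [i [TM ->]]] x [T' [j [TM' _ /region_subtri]]].
exact: region_closure.
Qed.

Lemma T1h_cover : Omega `<=` \bigcup_(K in T1h M) K.
Proof.
move=> x /mesh_subtri_cover[T [i [TM Tx]]].
by exists (edge_patch M T i); [exists T, i|exists T, i].
Qed.

(** A shared edge gives the same patch from both of its elements, so distinct patches are told apart
    by their edge segments. No element-index pair contributes to both, and the overlap lies in
    finitely many overlaps of subtriangles with distinct indices. *)
Lemma T1h_null K L : T1h M K -> T1h M L -> K <> L -> mu2.-negligible (K `&` L).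
Proof.
move=> [T [i [TM ->]]] [T' [j [TM' ->]]] KL.
have ee : segment (edge T i) <> segment (edge T' j).
  by move=> ee; apply: KL; rewrite /edge_patch ee.
pose D := [set p : (element k R * 'I_n) * (element k R * 'I_n) |
  [/\ p.1.1 \in M, p.2.1 \in M & p.1 != p.2]].
have finD : finite_set D.
  apply: (@sub_finite_set _ _ (([set` M] `*` [set: 'I_n]) `*` ([set` M] `*` [set: 'I_n]))).
    by move=> p [p1 p2 _].
  by do ! apply: finite_setX => //; exact: finite_finset.
have D0 : mu2.-negligible (\bigcup_(p in D) (subtri p.1.1 p.1.2 `&` subtri p.2.1 p.2.2)).
  apply: negligible_fin_bigcup => // -[[S l] [S' l']] [/= SM SM' Sl].
  exact: mesh_subtri_null.
apply: (negligibleS _ D0) => x [[S [l [SM Sl Sx]]] [S' [l' [SM' Sl' Sx']]]].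
exists ((S, l), (S', l')) => //; split => //=.
by apply: contra_not_neq ee => -[SS ll]; rewrite -Sl -Sl' SS ll.
Qed.

End Mesh.

(** * Differences in the displacement spaces and their strains *)

Section DisplacementSub.
Context {R : realType}.
Implicit Types u v : displacement R.

Definition disp_sub u v : displacement R := (h1_sub u.1 v.1, h1_sub u.2 v.2).

Lemma strainB u v : strain (disp_sub u v) = fun x => strain u x - strain v x.
Proof.
apply/funext => x; apply/colP => i; rewrite !mxE.
by case: i => [[|[|[|//]]] ?] //=; lra.
Qed.

Lemma affine_onB (A : set (R * R)) (f g : R * R -> R) :
  affine_on A f -> affine_on A g -> affine_on A (fun x => f x - g x).
Proof.
move=> [a [b [c fE]]] [a' [b' [c' gE]]].
by exists (a - a'), (b - b'), (c - c') => x Ax; rewrite fE // gE //; ring.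
Qed.

Variables (Omega : set (R * R)) (E : seq ((R * R) * (R * R))) (GD : set (R * R)).
Hypothesis polO : polygonal_domain Omega E.

Lemma in_VB u v : in_V Omega E GD u -> in_V Omega E GD v ->
  in_V Omega E GD (disp_sub u v).
Proof.
move=> [u1 u2 zu1 zu2] [v1 v2 zv1 zv2]; split.
- exact: in_H1B.
- exact: in_H1B.
- exact: zero_traceB.
- exact: zero_traceB.
Qed.

Lemma in_Vh_V (k : element_kind) (M : seq (element k R)) u :
  in_Vh Omega E GD M u -> in_V Omega E GD u.
Proof. by case: k M => M []. Qed.

Lemma in_VhB (k : element_kind) (M : seq (element k R)) u v :
  in_Vh Omega E GD M u -> in_Vh Omega E GD M v ->
  in_Vh Omega E GD M (disp_sub u v).
Proof.
case: k M => M [Vu Mu] [Vv Mv]; (split; first exact: in_VB) => T TM.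
  have [u1 u2] := Mu T TM; have [v1 v2] := Mv T TM.
  by split; exact: affine_onB.
have [au [u1 u2]] := Mu T TM; have [av [v1 v2]] := Mv T TM.
split; [|split] => /=.
- by move=> i; have [? ?] := au i; have [? ?] := av i; split; exact: affine_onB.
- by rewrite u1 v1 sumrB mulrBr.
- by rewrite u2 v2 sumrB mulrBr.
Qed.

Lemma strain_in_W u : in_V Omega E GD u -> in_W Omega (strain u).
Proof.
move=> [[_ u1x u1y _ _] [_ u2x u2y _ _] _ _] i.
have mO := domain_measurable polO.
rewrite (_ : (fun x => _) =
    fun x => [:: dx u.1 x; dy u.2 x; dy u.1 x + dx u.2 x]`_i); last first.
  by apply/funext => x; rewrite mxE.
case: i => [[|[|[|//]]] ?] //=.
exact: sq_integrableD.
Qed.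

End DisplacementSub.

(** * Energy products, Cauchy-Schwarz and the abstract error bound *)

Section Energy.
Context {R : realType}.
Variables (Omega : set (R * R)) (E : seq ((R * R) * (R * R))).
Hypothesis polO : polygonal_domain Omega E.
Implicit Types (eps sig tau : field3 R) (p q : 'cV[R]_3).

Let mO : measurable (Omega : set (mplane R)) := domain_measurable polO.
Let fO : (mu2 (Omega : set (mplane R)) < +oo)%E := domain_finite polO.

Lemma in_WB eps sig : in_W Omega eps -> in_W Omega sig ->
  in_W Omega (fun x => eps x - sig x).
Proof.
move=> We Ws i; rewrite (_ : (fun x => _) = fun x => eps x i 0 - sig x i 0).
  by apply: sq_integrableB => //; [exact: We|exact: Ws].
by apply/funext => x; rewrite !mxE.
Qed.

Lemma in_W_mulmx (D : 'M[R]_3) eps : in_W Omega eps ->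
  in_W Omega (fun x => D *m eps x).
Proof.
move=> We i; rewrite (_ : (fun x => _) = fun x => \sum_j D i j * eps x j 0).
  apply: sq_integrable_sum => // j.
  by apply: sq_integrableZ => //; exact: We.
by apply/funext => x; rewrite !mxE.
Qed.

Lemma ddot_integrable sig eps : in_W Omega sig -> in_W Omega eps ->
  mu2.-integrable Omega (fun x => (ddot (sig x) (eps x))%:E).
Proof.
move=> Ws We; rewrite /ddot.
have := integrable_sum mO (index_enum 'I_3) (P := xpredT)
  (fun i _ => sq_integrableM mO (Ws i) (We i)).
by apply: eq_integrable => // x _; rewrite sumEFin.
Qed.

Lemma ddotBl p p' q : ddot (p - p') q = ddot p q - ddot p' q.
Proof. by rewrite /ddot -sumrB; apply: eq_bigr => i _; rewrite !mxE mulrBl. Qed.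

Lemma ddotBr p q q' : ddot p (q - q') = ddot p q - ddot p q'.
Proof. by rewrite /ddot -sumrB; apply: eq_bigr => i _; rewrite !mxE mulrBr. Qed.

Lemma ddotZl (a : R) p q : ddot (a *: p) q = a * ddot p q.
Proof. by rewrite /ddot mulr_sumr; apply: eq_bigr => i _; rewrite !mxE mulrA. Qed.

Lemma ddotZr (a : R) p q : ddot p (a *: q) = a * ddot p q.
Proof. by rewrite /ddot mulr_sumr; apply: eq_bigr => i _; rewrite !mxE mulrCA. Qed.

Lemma ddotE p q : ddot p q = (p^T *m q) 0 0.
Proof. by rewrite mxE; apply: eq_bigr => i _; rewrite mxE. Qed.

Lemma pairingBl sig tau eps : in_W Omega sig -> in_W Omega tau -> in_W Omega eps ->
  pairing Omega (fun x => sig x - tau x) eps =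
  pairing Omega sig eps - pairing Omega tau eps.
Proof.
move=> Ws Wt We; rewrite /pairing -RintegralB //; [|exact: ddot_integrable..].
by apply: eq_Rintegral => x _; rewrite ddotBl.
Qed.

Lemma pairingBr sig eps tau : in_W Omega sig -> in_W Omega eps -> in_W Omega tau ->
  pairing Omega sig (fun x => eps x - tau x) =
  pairing Omega sig eps - pairing Omega sig tau.
Proof.
move=> Ws We Wt; rewrite /pairing -RintegralB //; [|exact: ddot_integrable..].
by apply: eq_Rintegral => x _; rewrite ddotBr.
Qed.

(** The numbers [n1] and [n2] will be the dual norms of the two stress errors; bounding the root of
    the sum of squares by the sum separates the two infima of the final estimate. *)
Lemma pairing_telescope_le sig tau1 tau2 e0 e1 e2 (C n1 n2 : R) :
  in_W Omega sig -> in_W Omega tau1 -> in_W Omega tau2 ->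
  in_W Omega e0 -> in_W Omega e1 -> in_W Omega e2 ->
  pairing Omega tau1 (fun x => e0 x - e1 x) = 0 ->
  pairing Omega tau2 (fun x => e1 x - e2 x) = 0 ->
  0 <= C -> 0 <= n1 -> 0 <= n2 ->
  pairing Omega (fun x => sig x - tau1 x) (fun x => e0 x - e1 x)
  + pairing Omega (fun x => sig x - tau2 x) (fun x => e1 x - e2 x)
  <= C * Num.sqrt (n1 ^+ 2 + n2 ^+ 2) ->
  pairing Omega sig e0 - pairing Omega sig e2 <= C * (n1 + n2).
Proof.
move=> Ws W1 W2 We0 We1 We2 o1 o2 C0 n10 n20.
have W01 := in_WB We0 We1; have W12 := in_WB We1 We2.
rewrite (pairingBl Ws W1 W01) (pairingBl Ws W2 W12) o1 o2 !subr0.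
rewrite (pairingBr Ws We0 We1) (pairingBr Ws We1 We2) addrA subrK.
move=> /le_trans; apply; apply: ler_wpM2l => //.
rewrite -(ger0_norm (addr_ge0 n10 n20)) -sqrtr_sqr ler_wsqrtr //.
have := mulr_ge0 n10 n20; rewrite sqrrD; lra.
Qed.

Variable D : 'M[R]_3.
Hypothesis Dpos : sym_posdef D.

Let ip eps tau : R := pairing Omega (fun x => D *m eps x) tau.

Lemma ddot_mulmxC p q : ddot (D *m p) q = ddot (D *m q) p.
Proof.
have DT := Dpos.1.
have h (M : 'M[R]_1) : M 0 0 = M^T 0 0 by rewrite mxE.
by rewrite !ddotE [RHS]h !trmx_mul !trmxK DT mulmxA.
Qed.

Lemma ddot_mulmx_ge0 p : 0 <= ddot (D *m p) p.
Proof.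
have [->|/Dpos.2/ltW //] := eqVneq p 0.
by rewrite mulmx0 /ddot big1 // => i _; rewrite mxE mul0r.
Qed.

Lemma energy_ge0 eps : 0 <= ip eps eps.
Proof. by apply: Rintegral_ge0 => x _; exact: ddot_mulmx_ge0. Qed.

Lemma normY_sqr eps : normY Omega D eps ^+ 2 = ip eps eps.
Proof. by rewrite /normY sqr_sqrtr //; exact: energy_ge0. Qed.

Lemma normY_ge0 eps : 0 <= normY Omega D eps.
Proof. exact: sqrtr_ge0. Qed.

(** One expansion with two uses: as a quadratic in [t] it yields Cauchy-Schwarz, at [t = 1] the
    triangle inequality. Symmetry of [D] merges the mixed terms. *)
Lemma energy_subZ eps tau (t : R) : in_W Omega eps -> in_W Omega tau ->
  ip (fun x => eps x - t *: tau x) (fun x => eps x - t *: tau x) =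
  ip eps eps - t * (2 * ip eps tau) + t ^+ 2 * ip tau tau.
Proof.
move=> We Wt; rewrite /ip /pairing.
have ee := ddot_integrable (in_W_mulmx D We) We.
have et := ddot_integrable (in_W_mulmx D We) Wt.
have tt := ddot_integrable (in_W_mulmx D Wt) Wt.
have iZ (c : R) f : mu2.-integrable Omega (EFin \o f) ->
    mu2.-integrable Omega (EFin \o (fun x => c * f x)).
  move=> intf; have := integrableZl mO c intf.
  by apply: eq_integrable => // x _; rewrite /= EFinM.
rewrite -(RintegralZl _ mO et) -(RintegralZl _ mO (iZ _ _ et)) -(RintegralZl _ mO tt).
rewrite -RintegralB //; last exact: (iZ _ _ (iZ _ _ et)).
rewrite -RintegralD //; last 2 first.
- exact: (integrableB mO ee (iZ _ _ (iZ _ _ et))).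
- exact: (iZ _ _ tt).
apply: eq_Rintegral => x _.
rewrite mulmxBr -scalemxAr !(ddotBl, ddotBr, ddotZl, ddotZr) (ddot_mulmxC (tau x)).
ring.
Qed.

(** The case [c = 0] matters because the energy is only a seminorm on functions: it vanishes on
    fields that are zero almost everywhere. *)
Lemma quadratic_ge0_discr (a b c : R) : 0 <= a -> 0 <= c ->
  (forall t, 0 <= a - t * (2 * b) + t ^+ 2 * c) -> b ^+ 2 <= a * c.
Proof.
move=> a0 c0 pos; have [cE|cN] := eqVneq c 0.
  have [->|bN] := eqVneq b 0; first by rewrite expr0n cE mulr0.
  (* At this point the linear expression takes the value -1. *)
  have := pos ((a + 1) / (2 * b)); rewrite cE mulr0 addr0 divfK ?mulf_neq0 //.
  lra.
have cp : 0 < c by rewrite lt_neqAle eq_sym cN.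
(* The minimizer of the quadratic. *)
have := pos (b / c).
have -> : a - b / c * (2 * b) + (b / c) ^+ 2 * c = (a * c - b ^+ 2) / c by field.
by rewrite pmulr_lge0 ?invr_gt0 // subr_ge0.
Qed.

Lemma energy_cauchy_schwarz eps tau : in_W Omega eps -> in_W Omega tau ->
  `|ip eps tau| <= normY Omega D eps * normY Omega D tau.
Proof.
move=> We Wt; rewrite -ler_sqr ?nnegrE ?mulr_ge0 ?normY_ge0 //.
rewrite real_normK ?num_real // exprMn !normY_sqr.
apply: quadratic_ge0_discr; [exact: energy_ge0..|] => t.
by rewrite -energy_subZ //; exact: energy_ge0.
Qed.

Lemma normYB_le eps tau : in_W Omega eps -> in_W Omega tau ->
  normY Omega D (fun x => eps x - tau x) <= normY Omega D eps + normY Omega D tau.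
Proof.
move=> We Wt; rewrite -ler_sqr ?nnegrE ?addr_ge0 ?normY_ge0 //.
have -> : (fun x => eps x - tau x) = (fun x => eps x - 1 *: tau x).
  by apply/funext => x; rewrite scale1r.
rewrite normY_sqr energy_subZ // sqrrD !normY_sqr.
have := energy_cauchy_schwarz We Wt; rewrite ler_norml => /andP[h _].
rewrite mul1r expr1n mul1r -mulr_natl; lra.
Qed.

(** [C] is the consistency error per unit of energy norm of the test strain. *)
Lemma strang_error_le eu eh ev (C : R) :
  in_W Omega eu -> in_W Omega eh -> in_W Omega ev -> 0 <= C ->
  ip eh (fun x => eh x - ev x) - ip eu (fun x => eh x - ev x)
    <= C * normY Omega D (fun x => eh x - ev x) ->
  normY Omega D (fun x => eu x - eh x)
    <= 2 * normY Omega D (fun x => eu x - ev x) + C.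
Proof.
move=> Weu Weh Wev C0; set ew := (fun x => eh x - ev x) => consistency.
have Wew : in_W Omega ew by exact: in_WB.
have Wuv : in_W Omega (fun x => eu x - ev x) by exact: in_WB.
have ipB e e' : in_W Omega e -> in_W Omega e' ->
    ip (fun x => e x - e' x) ew = ip e ew - ip e' ew.
  move=> We We'; rewrite /ip -(pairingBl (in_W_mulmx D We) (in_W_mulmx D We') Wew).
  by congr pairing; apply/funext => x; rewrite mulmxBr.
(* Inserting [ip eu ew] separates the consistency term from the approximation term. *)
have energy_w : normY Omega D ew ^+ 2 =
    ip eh ew - ip eu ew + ip (fun x => eu x - ev x) ew.
  rewrite normY_sqr (ipB eu ev Weu Wev).
  have : ip ew ew = ip eh ew - ip ev ew by exact: ipB.
  lra.
have := energy_cauchy_schwarz Wuv Wew.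
rewrite ler_norml => /andP[_ approximation].
have ew_le : normY Omega D ew <= normY Omega D (fun x => eu x - ev x) + C.
  have [ew0|ew0] := eqVneq (normY Omega D ew) 0.
    by rewrite ew0 addr_ge0 // normY_ge0.
  have ewp : 0 < normY Omega D ew by rewrite lt_neqAle eq_sym ew0 normY_ge0.
  rewrite -(ler_pM2r ewp) -expr2 energy_w; lra.
have -> : (fun x => eu x - eh x) = (fun x => (eu x - ev x) - ew x).
  by apply/funext => x; rewrite /ew opprB addrA subrK.
apply: le_trans (normYB_le Wuv Wew) _.
by rewrite mulr_natl mulr2n -addrA lerD2l.
Qed.

End Energy.

(** * The strain-smoothed element method *)

Section SmoothedStrain.
Context {k : element_kind} {R : realType}.
Variables (Omega : set (R * R)) (E : seq ((R * R) * (R * R))).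
Variable M : seq (element k R).
Hypothesis polO : polygonal_domain Omega E.
Hypothesis subM : subdivision_of Omega M.
Implicit Types (eps sig : field3 R) (u v : displacement R) (GD : set (R * R)).

Lemma P1h_in_W eps : in_W Omega (P1h Omega M eps).
Proof.
apply: (in_W_piecewise_mean polO); first exact: T1h_finite.
exact: T1h_measurable.
Qed.

Lemma P2h_in_W eps : in_W Omega (P2h Omega M eps).
Proof.
apply: (in_W_piecewise_mean polO); first exact: T2h_finite.
exact: T2h_measurable.
Qed.

Lemma P1h_orthogonal eps sig : in_W Omega eps -> in_Wh Omega (T1h M) sig ->
  pairing Omega sig (fun x => eps x - P1h Omega M eps x) = 0.
Proof.
apply: (piecewise_mean_orthogonal polO (T1h_finite M)).
- exact: T1h_measurable.
- exact: (T1h_sub subM).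
- exact: (T1h_cover subM).
- exact: (T1h_null subM).
Qed.

Lemma P2h_orthogonal eps sig : in_W Omega eps -> in_Wh Omega (T2h M) sig ->
  pairing Omega sig (fun x => eps x - P2h Omega M eps x) = 0.
Proof.
apply: (piecewise_mean_orthogonal polO (T2h_finite M)).
- exact: T2h_measurable.
- exact: (T2h_sub subM).
- exact: (T2h_cover subM).
- exact: (T2h_null subM).
Qed.

Lemma smoothed_strainB GD u v : in_V Omega E GD u -> in_V Omega E GD v ->
  smoothed_strain Omega M (disp_sub u v) =
  fun x => smoothed_strain Omega M u x - smoothed_strain Omega M v x.
Proof.
move=> Vu Vv; rewrite /smoothed_strain strainB.
have -> : P1h Omega M (fun x => strain u x - strain v x) =
    fun x => P1h Omega M (strain u) x - P1h Omega M (strain v) x.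
  apply/funext => x; apply: (piecewise_meanB polO).
  - exact: T1h_measurable.
  - exact: (strain_in_W polO Vu).
  - exact: (strain_in_W polO Vv).
apply/funext => x; apply: (piecewise_meanB polO); last 2 first.
- exact: P1h_in_W.
- exact: P1h_in_W.
- exact: T2h_measurable.
Qed.

Lemma smoothed_strain_error_le GD (D : 'M[R]_3) CB u uh v tau1 tau2 :
  sym_posdef D -> is_CB Omega E GD D M CB -> in_V Omega E GD u ->
  in_Vh Omega E GD M uh ->
  (forall w, in_Vh Omega E GD M w ->
     pairing Omega (fun x => D *m smoothed_strain Omega M uh x)
       (smoothed_strain Omega M w) = aform Omega D u w) ->
  in_Vh Omega E GD M v -> in_Wh Omega (T1h M) tau1 -> in_Wh Omega (T2h M) tau2 ->
  normY Omega D (fun x => strain u x - smoothed_strain Omega M uh x)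
  <= 2 * normY Omega D (fun x => strain u x - smoothed_strain Omega M v x)
     + CB * (normYs Omega D (fun x => stress D u x - tau1 x)
             + normYs Omega D (fun x => stress D u x - tau2 x)).
Proof.
move=> Dpos [CB0 CBP] Vu Vhuh galerkin Vhv W1 W2.
have Vuh := in_Vh_V Vhuh; have Vv := in_Vh_V Vhv.
pose w := disp_sub uh v.
have Vhw : in_Vh Omega E GD M w by exact: (in_VhB polO).
have Weu := strain_in_W polO Vu.
have Wbw := strain_in_W polO (in_Vh_V Vhw).
have Wp1 : in_W Omega (P1h Omega M (strain w)) := P1h_in_W _.
have Wsm y : in_W Omega (smoothed_strain Omega M y) by exact: P2h_in_W.
have Wsig : in_W Omega (stress D u) := in_W_mulmx polO D Weu.
have n0 tau : 0 <= normYs Omega D tau by exact: sqrtr_ge0.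
have C0 : 0 <= CB * normY Omega D (smoothed_strain Omega M w).
  by rewrite mulr_ge0 ?normY_ge0 // ltW.
apply: (strang_error_le polO Dpos Weu (Wsm uh) (Wsm v)).
  by rewrite mulr_ge0 ?addr_ge0 // ltW.
(* The Galerkin identity turns the first product into the stress of [u] paired with the unsmoothed
   strain of [w]; the norm of the smoothed strain joins [CB] to form the constant of the telescoped
   bound. *)
rewrite -(smoothed_strainB Vuh Vv) -/w (galerkin w Vhw) mulrAC.
apply: (pairing_telescope_le polO Wsig W1.1 W2.1 Wbw Wp1 (Wsm w)
  (P1h_orthogonal Wbw W1) (P2h_orthogonal Wp1 W2) C0 (n0 _) (n0 _)).
(* The inequality for [CB] is used on the discrete set Z_h, with the stress errors as dual
   fields. *)
apply: CBP; [by right; exists w|exact: (in_WB polO Wsig W1.1)|].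
exact: (in_WB polO Wsig W2.1).
Qed.

(** Makes the sets of stress errors nonempty, so that their infima are greatest lower bounds. *)
Lemma in_Wh0 (S : set (set (R * R))) : in_Wh Omega S (fun=> 0).
Proof.
split=> [i|K _]; last first.
  exists 0; apply: (@filterE _ _ (@ae_filter_ringOfSetsType _ _ R (@mu2 R))) => x.
  by [].
rewrite (_ : (fun x => _) = fun=> 0) ?funeqE => [|x]; last by rewrite mxE.
by apply: (continuous_L2 polO) => x; exact: cvg_cst.
Qed.

End SmoothedStrain.

(** * Passage to the infima *)

Lemma le_inf_image {R : realType} (I : Type) (P : set I) (F : I -> R) (x : R) :
  P !=set0 -> (forall i, P i -> x <= F i) -> x <= inf (F @` P).
Proof.
move=> [i Pi] xF; apply: lb_le_inf; first by exists (F i); exists i.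
by move=> _ [j Pj <-]; exact: xF.
Qed.

(** The bound is solved for one term at a time with the others fixed, so the infima enter one after
    another; positivity of [c] allows the division. *)
Lemma le_inf_image3 {R : realType} (I J K : Type) (P : set I) (Q : set J) (S : set K)
    (F : I -> R) (G : J -> R) (H : K -> R) (x c : R) :
  P !=set0 -> Q !=set0 -> S !=set0 -> 0 < c ->
  (forall i j k, P i -> Q j -> S k -> x <= 2 * F i + c * (G j + H k)) ->
  x <= 2 * inf (F @` P) + c * (inf (G @` Q) + inf (H @` S)).
Proof.
move=> P0 Q0 S0 c0 xFGH.
set f := inf (F @` P); set g := inf (G @` Q); set h := inf (H @` S).
have xFG i j : P i -> Q j -> x <= 2 * F i + c * (G j + h).
  move=> Pi Qj; have : (x - 2 * F i) / c - G j <= h.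
    apply: le_inf_image => // k Sk.
    by rewrite lerBlDl ler_pdivrMr // [_ * c]mulrC lerBlDl; exact: xFGH.
  by rewrite lerBlDl ler_pdivrMr // [_ * c]mulrC lerBlDl.
have xF i : P i -> x <= 2 * F i + c * (g + h).
  move=> Pi; have : (x - 2 * F i) / c - h <= g.
    apply: le_inf_image => // j Qj.
    by rewrite lerBlDr ler_pdivrMr // [_ * c]mulrC lerBlDl; exact: xFG.
  by rewrite lerBlDr ler_pdivrMr // [_ * c]mulrC lerBlDl.
have : (x - c * (g + h)) / 2 <= f.
  apply: le_inf_image => // i Pi.
  by rewrite ler_pdivrMr // [F i * 2]mulrC lerBlDr; exact: xF.
by rewrite ler_pdivrMr // [f * 2]mulrC lerBlDr.
Qed.

Unset Implicit Arguments.
Set Strict Implicit.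
Theorem corollary5p7 (R : realType) (k : element_kind)
  (Omega : set (R * R)) (E : seq ((R * R) * (R * R)))
  (GD GN : set (R * R)) (D : 'M[R]_3) (b t : R * R -> R * R)
  (hs : set R) (Th : R -> seq (element k R)) (h CB : R)
  (u uh : displacement R) :
  polygonal_domain Omega E ->
  boundary Omega = GD `|` GN -> GD !=set0 -> GN = boundary Omega `\` GD ->
  measurable (GD : set (mplane R)) ->
  sym_posdef D ->
  form_symmetric Omega E GD D ->
  form_continuous Omega E GD D ->
  form_coercive Omega E GD D ->
  continuous_load Omega E GD GN b t ->
  quasi_uniform_family Omega hs Th -> hs h ->
  is_CB Omega E GD D (Th h) CB ->
  in_V Omega E GD u ->
  (forall v, in_V Omega E GD v ->
     aform Omega D u v = load Omega E GN b t v) ->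
  in_Vh Omega E GD (Th h) uh ->
  (forall v, in_Vh Omega E GD (Th h) v ->
     pairing Omega (fun x => D *m smoothed_strain Omega (Th h) uh x)
                   (smoothed_strain Omega (Th h) v)
     = load Omega E GN b t v) ->
  normY Omega D (fun x => strain u x - smoothed_strain Omega (Th h) uh x)
  <= 2 * inf [set normY Omega D
                    (fun x => strain u x - smoothed_strain Omega (Th h) v x)
             | v in in_Vh Omega E GD (Th h)]
     + CB * (inf [set normYs Omega D (fun x => stress D u x - tau1 x)
                 | tau1 in in_Wh Omega (T1h (Th h))]
             + inf [set normYs Omega D (fun x => stress D u x - tau2 x)
                   | tau2 in in_Wh Omega (T2h (Th h))]).
Proof.
move=> polO _ _ _ _ Dpos _ _ _ _ [hsub _] hh CBP Vu uP Vhuh uhP.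
have [_ subM _] := hsub h hh.
apply: le_inf_image3.
- by exists uh.
- by exists (fun=> 0); exact: (in_Wh0 polO).
- by exists (fun=> 0); exact: (in_Wh0 polO).
- exact: CBP.1.
move=> v tau1 tau2; apply: (smoothed_strain_error_le polO subM Dpos CBP Vu Vhuh).
(* The displacement space is conforming: V_h lies in V, so [w] may test the exact problem too. *)
by move=> w Vhw; rewrite uhP // uP //; exact: in_Vh_V Vhw.
Qed.
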